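(* Let $v:[0,+\infty)\to(0,+\infty)$ be continuous and decreasing with $\lim_{r\to+\infty}r^m v(r)=0$ for all $m\in\mathbb N$. Assume that $\lim_{n\to \infty}\|u_n\|_v^{1/n} = \infty$ and that $\lim_{r\to \infty}\frac{v(tr)}{v(r)} = 0$ for every $t > 1$. Let $\mu$ be a positive Borel measure on $(0,\infty)$ such that $\mathcal{H}_\mu:H^\infty_v\to H^\infty_v$ is a bounded operator. The following conditions are equivalent: (i) $\mathcal{H}_\mu:H^\infty_v\to H^\infty_v$ is compact. (ii) $\mathcal{H}_\mu:H^0_v\to H^0_v$ is weakly compact. (iii) $\mu(\{1\}) = 0$.
   Context: Extend $v$ to $\mathbb C$ by $v(z)=v(|z|)$. $H^\infty_v$ is the Banach space of entire functions $f$ with $\|f\|_v=\sup_{z\in\mathbb C}|f(z)|v(z)<\infty$, and $H^0_v$ is its closed subspace of entire functions $f$ such that $|f|v$ vanishes at infinity, with the same norm. Here $u_n(z)=z^n$. The Hausdorff operator is $\mathcal{H}_\mu(f)(z)=\int_0^\infty f\left(\frac{z}{t}\right)\frac{d\mu(t)}{t}$ for entire $f$. It is known that when $\mathcal{H}_\mu:H^\infty_v\to H^\infty_v$ is bounded, it maps $H^0_v$ boundedly into $H^0_v$; the operator in (ii) is this restriction. *)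

(* Defs.v *)
From HB Require Import structures.
From mathcomp Require Import all_boot all_order all_algebra.
From mathcomp Require Import complex.
From mathcomp Require Import all_classical all_reals all_analysis.

Set Implicit Arguments.
Unset Strict Implicit.
Unset Printing Implicit Defensive.

Import Order.TTheory GRing.Theory Num.Theory.
Import numFieldNormedType.Exports.
Import Normc.

Local Open Scope classical_set_scope.
Local Open Scope ring_scope.
Local Open Scope complex_scope.

Section operators.
Variable K : numFieldType.
Implicit Types E F : normedModType K.

Definition bounded_operator E F (T : E -> F) :=
  exists M : K, forall x, `|T x| <= M * `|x|.

Definition compact_operator E F (T : E -> F) :=
  precompact (T @` [set x | `|x| <= 1]).

Definition dual E := {phi : {linear E -> K^o} | continuous phi}.

HB.instance Definition _ E := gen_eqMixin (dual E).
HB.instance Definition _ E := gen_choiceMixin (dual E).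

(* E with its weak topology sigma(E, dual E), i.e., the coarsest topology that
   makes every element of dual E continuous. *)
Definition weak E := initial_topology
  (fun x : E => (fun phi => sval phi x) : {ptws dual E -> K^o}).

Definition weakly_compact_operator E F (T : E -> F) :=
  precompact (T @` [set x | `|x| <= 1] : set (weak F)).

End operators.

Section weighted_spaces.
Variable R : realType.
Local Notation C := R[i].
Implicit Types (v : R -> {posnum R}) (f g : C -> C^o).

Definition entire f := forall z, derivable (f : C^o -> C^o) z 1.

(* Only the restriction of v to [0, +oo[ matters; v is extended to the complex
   plane by v(z) = v(|z|). *)
Definition wabs v f (z : C) : R := normc (f z) * (v (normc z))%:num.

Definition wnorm v f : \bar R := ereal_sup (range (fun z => (wabs v f z)%:E)).

Definition Hinf_pred v : {pred C -> C^o} :=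
  mem [set f | entire f /\ (wnorm v f < +oo)%E].

Record Hinf v := MkHinf { Hinf_fun :> C -> C^o ; _ : Hinf_fun \in Hinf_pred v }.

HB.instance Definition _ v := [isSub for @Hinf_fun v].
HB.instance Definition _ v := [Choice of Hinf v by <:].

Lemma normc_ge0 (z : C) : 0 <= normc z.
Proof. by case: z => a b; exact: sqrtr_ge0. Qed.

Lemma wabs_ge0 v f z : 0 <= wabs v f z.
Proof. by rewrite mulr_ge0// normc_ge0. Qed.

Lemma wnorm_ub v f z : ((wabs v f z)%:E <= wnorm v f)%E.
Proof. by apply: ereal_sup_ubound; exists z. Qed.

Lemma wnorm_ge0 v f : (0 <= wnorm v f)%E.
Proof. by apply: le_trans (wnorm_ub v f 0); rewrite lee_fin wabs_ge0. Qed.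

Lemma wnormD v f g : (wnorm v (f + g)%R <= wnorm v f + wnorm v g)%E.
Proof.
apply: ge_ereal_sup => _ [z _ <-].
apply: (@le_trans _ _ ((wabs v f z)%:E + (wabs v g z)%:E)%E).
  by rewrite -EFinD lee_fin /wabs -mulrDl ler_wpM2r// le_normcD.
by apply: leeD; exact: wnorm_ub.
Qed.

Lemma wnormZ_le v (a : C) f : (wnorm v (a *: f)%R <= (normc a)%:E * wnorm v f)%E.
Proof.
apply: ge_ereal_sup => _ [z _ <-].
apply: (@le_trans _ _ ((normc a)%:E * (wabs v f z)%:E)%E).
  by rewrite -EFinM lee_fin /wabs mulrA -normcM.
apply: lee_wpmul2l; last exact: wnorm_ub.
by rewrite lee_fin normc_ge0.
Qed.

Lemma Hinf_submod_closed v : submod_closed (Hinf_pred v).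
Proof.
split.
  rewrite inE; split; first by move=> z; exact: derivable_cst.
  apply: (@le_lt_trans _ _ 0%E) => //.
  apply: ge_ereal_sup => _ [z _ <-].
  by rewrite lee_fin /wabs normc0 mul0r.
move=> a f g; rewrite !inE => -[ef nf] [eg ng]; split.
  by move=> z; apply: derivableD => //; exact: derivableZ.
apply: le_lt_trans (wnormD _ _ _) _; rewrite lte_add_pinfty//.
apply: le_lt_trans (wnormZ_le _ _ _) _.
by rewrite lte_mul_pinfty// lee_fin normc_ge0.
Qed.

HB.instance Definition _ v :=
  GRing.isSubmodClosed.Build C (C -> C^o) (Hinf_pred v) (Hinf_submod_closed v).
HB.instance Definition _ v := [SubChoice_isSubLmodule of Hinf v by <:].

(* The norm of a normed space over C has values in C, hence the %:C. *)
Definition Hinf_norm v (f : Hinf v) : C := (fine (wnorm v f))%:C.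

Lemma wnorm_fineK v (f : Hinf v) : ((fine (wnorm v f))%:E = wnorm v f)%E.
Proof.
rewrite fineK// ge0_fin_numE ?wnorm_ge0//.
by case: f => f /=; rewrite inE => -[].
Qed.

Lemma Hinf_normD v (f g : Hinf v) :
  Hinf_norm (f + g) <= Hinf_norm f + Hinf_norm g.
Proof.
rewrite /Hinf_norm -rmorphD lecR -lee_fin EFinD !wnorm_fineK.
exact: wnormD.
Qed.

Lemma Hinf_normZ v (a : C) (f : Hinf v) :
  Hinf_norm (a *: f) = `|a| * Hinf_norm f.
Proof.
have nE (b : C) : `|b| = (normc b)%:C by [].
rewrite /Hinf_norm nE -rmorphM; congr (_%:C).
apply: EFin_inj; rewrite EFinM !wnorm_fineK.
apply/eqP; rewrite eq_le wnormZ_le /=.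
have [->|a0] := eqVneq a 0.
  by rewrite normc0 mul0e wnorm_ge0.
have na0 : 0 < normc a.
  rewrite lt_neqAle normc_ge0 andbT eq_sym.
  by apply: contra a0 => /eqP/eq0_normc ->.
rewrite -lee_pdivlMl//.
have := wnormZ_le v a^-1 (a *: (f : C -> C^o)).
by rewrite scalerA mulVf// scale1r normcV.
Qed.

Lemma Hinf_norm0_eq0 v (f : Hinf v) : Hinf_norm f = 0 -> f = 0.
Proof.
move=> [f0]; apply/val_inj/funext => z /=.
have := wnorm_ub v f z; rewrite -wnorm_fineK f0 lee_fin => w0.
have : wabs v f z == 0 by rewrite eq_le w0 wabs_ge0.
rewrite /wabs mulf_eq0 => /orP[/eqP/eq0_normc //|].
by rewrite gt_eqF.
Qed.

HB.instance Definition _ v := Lmodule_isNormed.Build C (Hinf v)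
  (@Hinf_normD v) (@Hinf_normZ v) (@Hinf_norm0_eq0 v).

Definition H0_pred v : {pred Hinf v} := mem [set f : Hinf v |
  forall e : R, 0 < e -> \forall r \near +oo, forall z, r <= normc z ->
    wabs v f z < e].

Record H0 v := MkH0 { H0_val :> Hinf v ; _ : H0_val \in @H0_pred v }.

HB.instance Definition _ v := [isSub for @H0_val v].
HB.instance Definition _ v := [Choice of H0 v by <:].

Lemma H0_submod_closed v : submod_closed (@H0_pred v).
Proof.
split.
  rewrite inE => e e0; near=> r => z _.
  by rewrite /wabs normc0 mul0r.
move=> a f g; rewrite !inE => fv gv e e0.
have a1 : 0 < normc a + 1.
  by rewrite ltr_wpDl// normc_ge0.
have ea : 0 < e / 2 / (normc a + 1) by rewrite !divr_gt0.
have e2 : 0 < e / 2 by rewrite divr_gt0.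
near=> r => z rz.
have fz : wabs v f z < e / 2 / (normc a + 1).
  by move: z rz; near: r; exact: fv.
have gz : wabs v g z < e / 2 by move: z rz {fz}; near: r; exact: gv.
apply: (@le_lt_trans _ _ ((normc a + 1) * wabs v f z + wabs v g z)).
  rewrite /wabs mulrA -mulrDl ler_wpM2r//.
  apply: le_trans (le_normcD _ _) _; rewrite lerD2r normcM.
  by rewrite ler_wpM2r ?lerDl// normc_ge0.
by rewrite [ltRHS]splitr ltrD// -ltr_pdivlMl// mulrC.
Unshelve. all: by end_near. Qed.

HB.instance Definition _ v :=
  GRing.isSubmodClosed.Build C (Hinf v) (@H0_pred v) (H0_submod_closed v).
HB.instance Definition _ v := [SubChoice_isSubLmodule of H0 v by <:].

Lemma H0_normD v (f g : H0 v) :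
  `|val (f + g)| <= `|val f| + `|val g|.
Proof. exact: ler_normD. Qed.

Lemma H0_normZ v (a : C) (f : H0 v) : `|val (a *: f)| = `|a| * `|val f|.
Proof. exact: normrZ. Qed.

Lemma H0_norm0_eq0 v (f : H0 v) : `|val f| = 0 -> f = 0.
Proof. by move=> /normr0_eq0 f0; exact: val_inj. Qed.

HB.instance Definition _ v := Lmodule_isNormed.Build C (H0 v)
  (@H0_normD v) (@H0_normZ v) (@H0_norm0_eq0 v).

End weighted_spaces.

Section hausdorff.
Variable R : realType.
Local Notation C := R[i].
(* A Borel measure on the half-line ]0, +oo[ is represented by a Borel measure
   on R, of which only the restriction to ]0, +oo[ is used. *)
Variable mu : {measure set (measurableTypeR R) -> \bar R}.

Definition complex_integrable (D : set (measurableTypeR R)) (h : R -> C) :=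
  mu.-integrable D (fun t => (complex.Re (h t))%:E) /\
  mu.-integrable D (fun t => (complex.Im (h t))%:E).

Definition complex_integral (D : set (measurableTypeR R)) (h : R -> C) : C :=
  (\int[mu]_(t in D) complex.Re (h t)) +i* (\int[mu]_(t in D) complex.Im (h t)).

Definition hausdorff_integrand (f : C -> C^o) (z : C) (t : R) : C :=
  f (z / t%:C) / t%:C.

Definition hausdorff (f : C -> C^o) : C -> C^o := fun z =>
  complex_integral `]0, +oo[ (hausdorff_integrand f z).

Variable v : R -> {posnum R}.

(* H_mu on H^oo_v; insubd returns the default value 0 when H_mu f is not in
   H^oo_v, a case excluded by hausdorff_bounded. *)
Definition hausdorff_inf (f : Hinf v) : Hinf v :=
  insubd (0 : Hinf v) (hausdorff f).

(* H_mu is well defined from H^oo_v to H^oo_v (the defining integrals converge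
   and H_mu f belongs to H^oo_v), and it is bounded. *)
Definition hausdorff_bounded :=
  [/\ forall (f : Hinf v) z,
        complex_integrable `]0, +oo[ (hausdorff_integrand f z),
      forall f : Hinf v, hausdorff f \in Hinf_pred v
    & bounded_operator hausdorff_inf].

Lemma hausdorff_infE (f : Hinf v) : hausdorff_bounded ->
  hausdorff_inf f = hausdorff f :> (C -> C^o).
Proof. by case=> _ /(_ f) hf _; rewrite -[LHS]/(val _) insubdK. Qed.

(* Restriction of H_mu to H^0_v; when v is nonincreasing and rapidly decreasing
   and hausdorff_bounded holds, H_mu maps H^0_v into itself, so that the default
   value 0 is never used. *)
Definition hausdorff_0 (f : H0 v) : H0 v :=
  insubd (0 : H0 v) (hausdorff_inf f).

End hausdorff.

(* Main.v *)
(* A bounded Hausdorff operator acts on z^n by multiplication by the moment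
   int t^(-n-1) dmu, so that these moments are bounded and mu(]0, 1[) = 0. Hence
   H f = mu({1}) f + T f, where T f integrates over t > 1 only, and
   |T f(z)| v(z) <= 2 ||f|| eps(|z|) with
   eps(r) = int_(t > 1) v(r) / v(r/t) dmu(t)/t; by dominated convergence the
   hypothesis v(tr)/v(r) -> 0 gives eps(r) -> 0.

   If mu({1}) = 0, then H = T. By Montel's theorem an ultrafilter on the unit ball
   converges locally uniformly to some f in the ball; T f' is close to T f along
   the ultrafilter, on discs by local uniform convergence and near infinity
   because of eps. Montel's theorem is obtained from Cauchy's formula on circles,
   which follows from Goursat's theorem on rectangles in logarithmic coordinates.

   If mu({1}) > 0, a gliding hump yields a bounded sequence of polynomials F_m and
   points r_k -> oo with F_m(r_k) v(r_k) >= 1/2 for all m > k. A weak cluster point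
   g of H F_m is a pointwise cluster point, and as T F_m is small near infinity
   |g(r_k)| v(r_k) stays away from 0, contradicting g in H^0_v.

   Finally, H^0_v is closed in H^oo_v, and compactness on the latter passes to it. *)
From HB Require Import structures.
From mathcomp Require Import all_boot all_order all_algebra.
From mathcomp Require Import complex.
From mathcomp Require Import all_classical all_reals all_analysis.
From mathcomp Require Import measurable_realfun.
From mathcomp Require Import ring lra.
Require Import Defs.

Set Implicit Arguments.
Unset Strict Implicit.
Unset Printing Implicit Defensive.

Import Order.TTheory GRing.Theory Num.Theory.
Import numFieldNormedType.Exports.
Import Normc.

Local Open Scope classical_set_scope.
Local Open Scope ring_scope.
Local Open Scope complex_scope.

(** * Complex derivatives and integrals *)

(** That [mu] vanishes on ]0, 1[ is what makes T tractable. For t > 1 the value T f(z) reads f only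
    at points z / t of the disc of radius |z|, so uniform convergence of f on a disc controls T f
    there. Moreover v(r) / v(r/t) is then at most 1, so 1/t, integrable as the moment of order 0,
    dominates the integrand of eps. The remaining term mu({1}) f is a multiple of the identity, and
    the gliding hump shows that this multiple cannot be weakly compact unless it is 0. The F_m must
    stay bounded while each keeps its size at all earlier points r_k. Boundedness holds because a
    normalised monomial of high degree is negligible on a given disc; persistence holds because the
    coefficients are nonnegative, so nothing cancels on the positive half-line. From (ii) to (iii)
    the weak topology is used only through point evaluations, so neither the dual nor the bidual of
    [H0 v] has to be described. In Montel's theorem a second order Taylor bound, uniform on the unit
    ball, serves twice: it makes the ball equi-Lipschitz on discs, and it survives pointwise limits,
    which makes the limit entire. *)

Section complex_numbers.
Variable R : realType.
Local Notation C := R[i].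
Implicit Types (z w : C) (f : C -> C^o).

Lemma normr_normc z : `|z| = (normc z)%:C.
Proof. by []. Qed.

Lemma normc_le_norm z (e : R) : (normc z <= e) = (`|z| <= e%:C).
Proof. by rewrite normr_normc lecR. Qed.

Lemma normc_lt_norm z (e : R) : (normc z < e) = (`|z| < e%:C).
Proof. by rewrite normr_normc ltcR. Qed.

Lemma normc_eq0 z : (normc z == 0) = (z == 0).
Proof.
by apply/eqP/eqP => [/eq0_normc|->]; rewrite ?normc0.
Qed.

Lemma normc_gt0 z : (0 < normc z) = (z != 0).
Proof. by rewrite lt_neqAle normc_ge0 andbT eq_sym normc_eq0. Qed.

Lemma normcB z w : normc (z - w) = normc (w - z).
Proof. by rewrite -normcN opprB. Qed.

Lemma le_normcB z w : normc z - normc w <= normc (z - w).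
Proof. by rewrite lerBlDr; rewrite -{1}(subrK w z) le_normcD. Qed.

Lemma normc_real (x : R) : normc x%:C = `|x|.
Proof. by rewrite /normc/= expr0n/= addr0 sqrtr_sqr. Qed.

Lemma normcX z n : normc (z ^+ n) = normc z ^+ n.
Proof.
by elim: n => [|n IH]; rewrite ?expr0 ?normc1// !exprS normcM IH.
Qed.

Lemma gt0_RRe z : 0 < z -> z = (complex.Re z)%:C.
Proof. by rewrite ltcE/= => /andP[/eqP]; case: z => a b /= ->. Qed.

Lemma normc_div z w : normc (z / w) = normc z / normc w.
Proof. by rewrite normcM normcV. Qed.

Lemma normc_Re z : `|complex.Re z| <= normc z.
Proof.
case: z => a b /=; rewrite -sqrtr_sqr ler_sqrt ?lerDl ?sqr_ge0//.
by rewrite addr_ge0 ?sqr_ge0.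
Qed.

Lemma normc_Im z : `|complex.Im z| <= normc z.
Proof.
case: z => a b /=; rewrite -sqrtr_sqr ler_sqrt ?lerDr ?sqr_ge0//.
by rewrite addr_ge0 ?sqr_ge0.
Qed.

Lemma normc_le_ReIm z : normc z <= `|complex.Re z| + `|complex.Im z|.
Proof.
case: z => a b /=.
rewrite -[leRHS]ger0_norm ?addr_ge0// -sqrtr_sqr ler_sqrt ?sqr_ge0//.
rewrite -(real_normK (num_real a)) -(real_normK (num_real b)).
have := normr_ge0 a; have := normr_ge0 b; nra.
Qed.

Lemma cReD z w : complex.Re (z + w) = complex.Re z + complex.Re w.
Proof. by case: z w => ? ? []. Qed.

Lemma cImD z w : complex.Im (z + w) = complex.Im z + complex.Im w.
Proof. by case: z w => ? ? []. Qed.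

Lemma cReN z : complex.Re (- z) = - complex.Re z.
Proof. by case: z. Qed.

Lemma cImN z : complex.Im (- z) = - complex.Im z.
Proof. by case: z. Qed.

Lemma cReM z w : complex.Re (z * w) =
  complex.Re z * complex.Re w - complex.Im z * complex.Im w.
Proof. by case: z w => ? ? []. Qed.

Lemma cImM z w : complex.Im (z * w) =
  complex.Re z * complex.Im w + complex.Im z * complex.Re w.
Proof. by case: z w => ? ? []. Qed.

(* The norm of C is C-valued; limits are therefore expressed with the real-valued
   [normc]. *)
Definition cderiv f z d := forall e : R, 0 < e -> exists2 de : R, 0 < de &
  forall w, normc (w - z) < de ->
    normc (f w - f z - d * (w - z)) <= e * normc (w - z).

Lemma derivable_cderiv f z : derivable (f : C^o -> C^o) z 1 ->
  exists d, cderiv f z d.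
Proof.
move=> /cvg_ex[d fd]; exists d => e e0.
have /cvgrPdist_le/(_ e%:C) := fd; rewrite ltcR => /(_ e0).
rewrite near_withinE => /nbhs_ballP[de /= de0 h].
have deE := gt0_RRe de0.
exists (complex.Re de).
  by move: de0; rewrite deE ltcR.
move=> w wz; have [->|wz0] := eqVneq w z.
  by rewrite !subrr mulr0 subrr normc0 mulr0.
have := h (w - z); rewrite /ball/= sub0r normrN => /(_ _ _) /=.
rewrite subr_eq0 wz0 deE -normc_lt_norm wz => /(_ isT isT).
rewrite -normc_le_norm => {}h.
have wz1 : w - z != 0 by rewrite subr_eq0.
have -> : f w - f z - d * (w - z) = - (w - z) * (d - (w - z)^-1 * (f w - f z)).
  by rewrite [RHS]mulrBr !mulNr opprK mulrA divff// mul1r addrC mulrC.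
rewrite normcM normcN mulrC ler_wpM2r ?normc_ge0//.
by move: h; rewrite /GRing.scale/= mulr1 subrK.
Qed.

Lemma cderiv_derivable f z d : cderiv f z d -> derivable (f : C^o -> C^o) z 1.
Proof.
move=> fd; apply/cvg_ex; exists d; apply/cvgrPdist_le => e e0.
have eE := gt0_RRe e0.
have re0 : 0 < complex.Re e by move: e0; rewrite eE ltcR.
have [de de0 h] := fd _ re0.
rewrite near_withinE; apply/nbhs_ballP; exists de%:C; first by rewrite /= ltcR.
move=> k /=; rewrite /ball/= sub0r normrN -normc_lt_norm => kde k0.
rewrite eE -normc_le_norm.
have := h (k + z); rewrite addrK => /(_ kde).
rewrite /GRing.scale/= mulr1 => {}h.
have -> : d - k^-1 * (f (k + z) - f z) = - k^-1 * (f (k + z) - f z - d * k).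
  rewrite [in RHS]mulrBr !mulNr opprK [d * k]mulrC mulrA mulVf// mul1r.
  by rewrite addrC.
rewrite normcM normcN normcV mulrC ler_pdivrMr ?normc_gt0//.
Qed.

Definition ccont f z := forall e : R, 0 < e -> exists2 de : R, 0 < de &
  forall w, normc (w - z) < de -> normc (f w - f z) <= e.

Lemma cderiv_ccont f z d : cderiv f z d -> ccont f z.
Proof.
move=> fd e e0; have [de de0 h] := fd 1 ltr01.
have K0 : 0 < 1 + normc d by rewrite ltr_pwDl// normc_ge0.
exists (Num.min de (e / (1 + normc d))); first by rewrite lt_min de0 divr_gt0.
move=> w; rewrite lt_min => /andP[/h {}h]; rewrite ltr_pdivlMr// => we.
apply: le_trans (ltW we).
rewrite -(subrK (d * (w - z)) (f w - f z)).
apply: le_trans (le_normcD _ _) _.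
by rewrite [leRHS]mulrDr mulr1 normcM lerD// ?(le_trans h) ?mul1r// mulrC.
Qed.

End complex_numbers.
Arguments normc : simpl never.

Section complex_integral.
Variables (R : realType) (mu : {measure set (measurableTypeR R) -> \bar R}).
Local Notation C := R[i].
Variable D : set (measurableTypeR R).
Hypothesis mD : measurable D.
Implicit Types h g : R -> C.

Lemma eq_complex_integral h g : {in D, h =1 g} ->
  complex_integral mu D h = complex_integral mu D g.
Proof.
by move=> hg; congr (_ +i* _); apply: eq_Rintegral => t tD; rewrite hg.
Qed.

Lemma eq_complex_integrable h g : {in D, h =1 g} ->
  complex_integrable mu D h -> complex_integrable mu D g.
Proof.
move=> hg [hr hi]; split; [apply: eq_integrable hr|apply: eq_integrable hi] => //;
by move=> t tD; rewrite hg.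
Qed.

Lemma complex_integrableD h g : complex_integrable mu D h ->
  complex_integrable mu D g -> complex_integrable mu D (fun t => h t + g t).
Proof.
move=> [hr hi] [gr gi]; split.
  under eq_fun do rewrite cReD EFinD.
  exact: integrableD.
under eq_fun do rewrite cImD EFinD.
exact: integrableD.
Qed.

Lemma complex_integrableZ (c : C) h : complex_integrable mu D h ->
  complex_integrable mu D (fun t => c * h t).
Proof.
move=> [hr hi]; split.
  under eq_fun do rewrite cReM EFinB 2!EFinM.
  by apply: integrableB => //; exact: integrableZl.
under eq_fun do rewrite cImM EFinD 2!EFinM.
by apply: integrableD => //; exact: integrableZl.
Qed.

Lemma complex_integrableB h g : complex_integrable mu D h ->
  complex_integrable mu D g -> complex_integrable mu D (fun t => h t - g t).
Proof.
move=> hi /(complex_integrableZ (-1)) gi.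
have := complex_integrableD hi gi; apply: eq_complex_integrable => t _.
by rewrite mulN1r.
Qed.

Lemma complex_integralD h g : complex_integrable mu D h ->
  complex_integrable mu D g -> complex_integral mu D (fun t => h t + g t) =
  complex_integral mu D h + complex_integral mu D g.
Proof.
move=> [hr hi] [gr gi]; apply/eqP; rewrite eq_complex cReD cImD /=.
apply/andP; split; apply/eqP.
  by rewrite -RintegralD//; apply: eq_Rintegral => t _; rewrite cReD.
by rewrite -RintegralD//; apply: eq_Rintegral => t _; rewrite cImD.
Qed.

Lemma complex_integralZ (c : C) h : complex_integrable mu D h ->
  complex_integral mu D (fun t => c * h t) = c * complex_integral mu D h.
Proof.
move=> [hr hi].
have int_Z (a : R) (k : R -> R) : mu.-integrable D (EFin \o k) ->
    mu.-integrable D (EFin \o (fun t => a * k t)).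
  move=> ki; apply: eq_integrable (integrableZl mD a ki) => // t _.
apply/eqP; rewrite eq_complex cReM cImM /=; apply/andP; split; apply/eqP.
  rewrite -!RintegralZl//  -RintegralB//; try exact: int_Z.
  by apply: eq_Rintegral => t _; rewrite cReM.
rewrite -!RintegralZl//  -RintegralD//; try exact: int_Z.
by apply: eq_Rintegral => t _; rewrite cImM.
Qed.

Lemma complex_integralB h g : complex_integrable mu D h ->
  complex_integrable mu D g -> complex_integral mu D (fun t => h t - g t) =
  complex_integral mu D h - complex_integral mu D g.
Proof.
move=> hi gi; rewrite -[- complex_integral mu D g]mulN1r -complex_integralZ//.
rewrite -complex_integralD//; last exact: complex_integrableZ.
by apply: eq_complex_integral => t _; rewrite mulN1r.
Qed.

(* Bounding the real and imaginary parts separately costs the factor 2. *)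
Lemma normc_complex_integral_le h (G : R -> R) : complex_integrable mu D h ->
  mu.-integrable D (EFin \o G) -> (forall t, D t -> normc (h t) <= G t) ->
  normc (complex_integral mu D h) <= 2 * \int[mu]_(t in D) G t.
Proof.
move=> [hr hi] Gi hG; apply: le_trans (normc_le_ReIm _) _ => /=.
have bound (k : R -> R) : mu.-integrable D (EFin \o k) ->
    (forall t, D t -> `|k t| <= normc (h t)) ->
    `|\int[mu]_(t in D) k t| <= \int[mu]_(t in D) G t.
  move=> ki kh; apply: le_trans (le_normr_Rintegral _ ki) _ => //.
  apply: le_Rintegral => //; first exact: (integrable_norm ki).
  by move=> t Dt; apply: le_trans (kh t Dt) (hG t Dt).
rewrite mulr2n mulrDl mul1r lerD//.
  by apply: bound => // t _; exact: normc_Re.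
by apply: bound => // t _; exact: normc_Im.
Qed.

End complex_integral.

(** * Goursat's theorem *)

Section interval_integral.
Variable R : realType.
Local Notation C := R[i].
Implicit Types (a b c d x y : R) (phi psi : R -> C).

Definition path_cont phi x := forall e : R, 0 < e -> exists2 de : R, 0 < de &
  forall y, `|y - x| < de -> normc (phi y - phi x) <= e.

Definition cint a b phi : C :=
  complex_integral (@lebesgue_measure R) `[a, b]%classic phi.

Definition cintegrable a b phi :=
  complex_integrable (@lebesgue_measure R) `[a, b]%classic phi.

Lemma path_cont_integrable a b phi :
  (forall x, a <= x <= b -> path_cont phi x) -> cintegrable a b phi.
Proof.
move=> cphi.
have cont (p : C -> R) : (forall z w, `|p z - p w| <= normc (z - w)) ->
    {within `[a, b], continuous (p \o phi)}.
  move=> lp; apply/subspace_continuousP => x /=; rewrite in_itv/= => xab.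
  apply/cvgrPdist_le => e e0; have [de de0 h] := cphi x xab e e0.
  rewrite near_withinE; apply/nbhs_ballP; exists de => //= y xy _.
  by rewrite distrC (le_trans (lp _ _))// h// distrC.
split; apply: continuous_compact_integrable; try exact: segment_compact.
  by apply: (cont (@complex.Re R)) => z w; rewrite -cReN -cReD normc_Re.
by apply: (cont (@complex.Im R)) => z w; rewrite -cImN -cImD normc_Im.
Qed.

Lemma cint_cst a b (k : C) : a <= b -> cint a b (fun=> k) = k * (b - a)%:C.
Proof.
move=> ab; rewrite /cint /complex_integral !Rintegral_cst//=.
rewrite lebesgue_measure_itv/= lte_fin.
have -> : fine (if (a < b)%R then b%:E - a%:E else 0)%E = b - a.
  by case: ltgtP ab => //= -> _; rewrite subrr.
by apply/eqP; rewrite eq_complex cReM cImM /= !mulr0 subr0 add0r !eqxx.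
Qed.

Lemma cintegrable_cst a b (k : C) : cintegrable a b (fun=> k).
Proof.
apply: path_cont_integrable => x _ e e0; exists 1 => // y _.
by rewrite subrr normc0 ltW.
Qed.

Lemma cint_split a m b phi : a <= m <= b -> cintegrable a b phi ->
  cint a b phi = cint a m phi + cint m b phi.
Proof.
move=> /andP[am mb] [hr hi].
have split (k : R -> R) : (@lebesgue_measure R).-integrable `[a, b] (EFin \o k) ->
    \int[lebesgue_measure]_(x in `[a, b]) k x =
    \int[lebesgue_measure]_(x in `[a, m]) k x +
    \int[lebesgue_measure]_(x in `[m, b]) k x.
  move=> ki.
  have kmb : (@lebesgue_measure R).-integrable `[m, b] (EFin \o k).
    by apply: integrableS ki => //; apply: subset_itvr; rewrite bnd_simp.
  (* The difference of the integrals lives on []m, b]]; the endpoint m that it misses is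
     Lebesgue-null. *)
  have := @Rintegral_itvB R k (BLeft a) (BRight b) m ki.
  rewrite !bnd_simp => /(_ am mb).
  rewrite (@Rintegral_itv_obnd_cbnd R m (BRight b) k); last first.
    apply: integrableS kmb => //.
    by apply: subset_itvr; rewrite bnd_simp.
  by move=> <-; rewrite addrC subrK.
by apply/eqP; rewrite eq_complex cReD cImD /= -!split ?eqxx.
Qed.

(** Used with the nearly constant difference of opposite sides of a small rectangle, with a kernel
    close to 1 on a large circle, and with k = 0 as the plain bound. *)
Lemma cint_near_cst a b phi (k : C) (e : R) : a <= b -> cintegrable a b phi ->
  (forall t, a <= t <= b -> normc (phi t - k) <= e) ->
  normc (cint a b phi - k * (b - a)%:C) <= 2 * (e * (b - a)).
Proof.
move=> ab hphi phik; rewrite -cint_cst// -complex_integralB//; last first.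
  exact: cintegrable_cst.
apply: le_trans (@normc_complex_integral_le _ _ _ _ _ (fun=> e) _ _ _) _ => //.
- exact: (complex_integrableB _ hphi (cintegrable_cst _ _ _)).
- have : {within `[a, b], continuous (cst e : R -> R)}.
    by apply: continuous_subspaceT => x; exact: cvg_cst.
  by apply: continuous_compact_integrable; exact: segment_compact.
rewrite ler_pM2l// Rintegral_cst//= lebesgue_measure_itv/= lte_fin.
by case: ltgtP ab => //= -> _; rewrite subrr.
Qed.

Lemma normc_cint_le a b phi (e : R) : a <= b -> cintegrable a b phi ->
  (forall t, a <= t <= b -> normc (phi t) <= e) ->
  normc (cint a b phi) <= 2 * (e * (b - a)).
Proof.
move=> ab hphi phie; have := @cint_near_cst a b phi 0 e ab hphi.
by rewrite mul0r subr0; apply=> t /phie; rewrite subr0.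
Qed.

End interval_integral.

Section goursat.
Variables (R : realType) (g : R -> R -> R[i]).
Local Notation C := R[i].
Implicit Types (a b c d x y : R).

(** Complex differentiability of [g] in the variable x + iy. The coordinates are kept apart because
    rectangles are integrated side by side. *)
Definition gderiv x y (D : C) := forall e : R, 0 < e -> exists2 de : R, 0 < de &
  forall x' y', `|x' - x| < de -> `|y' - y| < de ->
    normc (g x' y' - g x y - D * ((x' - x) +i* (y' - y))) <=
    e * (`|x' - x| + `|y' - y|).

Lemma normc_pair (x y : R) : normc (x +i* y) <= `|x| + `|y|.
Proof. exact: normc_le_ReIm. Qed.

Lemma gderiv_cont x y D : gderiv x y D -> forall e : R, 0 < e ->
  exists2 de : R, 0 < de & forall x' y', `|x' - x| < de -> `|y' - y| < de ->
    normc (g x' y' - g x y) <= e.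
Proof.
move=> gD e e0; have [de de0 h] := gD 1 ltr01.
have K0 : 0 < 1 + normc D by rewrite ltr_pwDl// normc_ge0.
have e'0 : 0 < e / 2 / (1 + normc D) by rewrite !divr_gt0.
exists (Num.min de (e / 2 / (1 + normc D))); first by rewrite lt_min de0.
move=> x' y'; rewrite !lt_min => /andP[x'de x'e] /andP[y'de y'e].
have := h x' y' x'de y'de; rewrite mul1r => {}h.
rewrite -(subrK (D * ((x' - x) +i* (y' - y))) (g x' y' - g x y)).
apply: le_trans (le_normcD _ _) _.
apply: (@le_trans _ _ ((1 + normc D) * (`|x' - x| + `|y' - y|))).
  rewrite [leRHS]mulrDl mul1r lerD// normcM ler_wpM2l ?normc_ge0//.
  exact: normc_pair.
rewrite mulrC -ler_pdivlMr//.
have -> : e / (1 + normc D) = e / 2 / (1 + normc D) + e / 2 / (1 + normc D).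
  by rewrite -mulrDl -splitr.
by rewrite lerD// ltW.
Qed.

(** The counterclockwise integral of g dz: bottom minus top, then right minus left with dz = i
    dy. *)
Definition boundary_int a b c d : C :=
  cint a b (fun x => g x c - g x d) + 'i * cint c d (fun y => g b y - g a y).

Definition holo_rect a b c d :=
  forall x y, a <= x <= b -> c <= y <= d -> exists D, gderiv x y D.

Lemma holo_rectS a b c d a' b' c' d' : a <= a' -> b' <= b -> c <= c' ->
  d' <= d -> holo_rect a b c d -> holo_rect a' b' c' d'.
Proof.
move=> aa bb cc dd h x y /andP[ax xb] /andP[cy yd]; apply: h.
  by rewrite (le_trans aa ax) (le_trans xb bb).
by rewrite (le_trans cc cy) (le_trans yd dd).
Qed.

Lemma holo_rect_intx a b c d y : holo_rect a b c d -> c <= y <= d ->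
  cintegrable a b (g ^~ y).
Proof.
move=> h ycd; apply: path_cont_integrable => x xab e e0.
have [D /gderiv_cont/(_ _ e0)[de de0 gde]] := h x y xab ycd.
by exists de => // x' x'x; apply: gde => //; rewrite subrr normr0.
Qed.

Lemma holo_rect_inty a b c d x : holo_rect a b c d -> a <= x <= b ->
  cintegrable c d (g x).
Proof.
move=> h xab; apply: path_cont_integrable => y ycd e e0.
have [D /gderiv_cont/(_ _ e0)[de de0 gde]] := h x y xab ycd.
by exists de => // y' y'y; apply: gde => //; rewrite subrr normr0.
Qed.

Lemma boundary_int_splitx a m b c d : c <= d -> a <= m <= b ->
  holo_rect a b c d ->
  boundary_int a b c d = boundary_int a m c d + boundary_int m b c d.
Proof.
move=> cd /andP[am mb] h; rewrite /boundary_int.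
have ab := le_trans am mb.
have ix y : c <= y <= d -> cintegrable a b (g ^~ y) := holo_rect_intx h.
have iy x : a <= x <= b -> cintegrable c d (g x) := holo_rect_inty h.
rewrite (@cint_split _ a m b); last 2 first.
- by rewrite am.
- by apply: complex_integrableB => //; apply: ix; rewrite lexx ?cd.
rewrite /cint !(@complex_integralB _ _ `[c, d]%classic)//;
  try by apply: iy; rewrite ?lexx ?am ?mb ?ab.
ring.
Qed.

Lemma boundary_int_splity a b c m d : a <= b -> c <= m <= d ->
  holo_rect a b c d ->
  boundary_int a b c d = boundary_int a b c m + boundary_int a b m d.
Proof.
move=> ab /andP[cm md] h; rewrite /boundary_int.
have cd := le_trans cm md.
have ix y : c <= y <= d -> cintegrable a b (g ^~ y) := holo_rect_intx h.
have iy x : a <= x <= b -> cintegrable c d (g x) := holo_rect_inty h.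
rewrite (@cint_split _ c m d); last 2 first.
- by rewrite cm.
- by apply: complex_integrableB => //; apply: iy; rewrite lexx ?ab.
rewrite /cint !(@complex_integralB _ _ `[a, b]%classic)//;
  try by apply: ix; rewrite ?lexx ?cm ?md ?cd.
ring.
Qed.

(** Up to small errors [g] differs between bottom and top by -iDH, and between right and left by DW.
    Integrated, these contribute -iDHW and iDWH, which cancel; only the errors remain. *)
Lemma boundary_int_small x y (e : R) : (exists D, gderiv x y D) -> 0 < e ->
  exists2 de : R, 0 < de & forall a b c d, a <= x <= b -> c <= y <= d ->
    b - a < de -> d - c < de -> holo_rect a b c d ->
    normc (boundary_int a b c d) <= e * ((b - a) + (d - c)) ^+ 2.
Proof.
(* Comparing two points through (x, y) doubles e / 4, and the factor 2 of [cint_near_cst] doubles it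
   again, which gives e (W + H) W + e (W + H) H. *)
move=> [D gD] e0; have e4 : 0 < e / 4 by rewrite divr_gt0.
have [de de0 h] := gD _ e4; exists de => // a b c d xab ycd bad dcd hr.
have [/andP[ax xb] /andP[cy yd]] := (xab, ycd).
have ab := le_trans ax xb; have cd := le_trans cy yd.
set W := b - a; set H := d - c.
have W0 : 0 <= W by rewrite subr_ge0.
have H0 : 0 <= H by rewrite subr_ge0.
have loc x' y' : a <= x' <= b -> c <= y' <= d ->
    normc (g x' y' - g x y - D * ((x' - x) +i* (y' - y))) <= e / 4 * (W + H).
  move=> /andP[ax' x'b] /andP[cy' y'd].
  have xx : `|x' - x| <= W by rewrite ler_norml /W; apply/andP; split; lra.
  have yy : `|y' - y| <= H by rewrite ler_norml /H; apply/andP; split; lra.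
  apply: le_trans (h x' y' (le_lt_trans xx bad) (le_lt_trans yy dcd)) _.
  by rewrite ler_pM2l// lerD.
have diff x1 y1 x2 y2 : a <= x1 <= b -> c <= y1 <= d -> a <= x2 <= b ->
    c <= y2 <= d ->
    normc (g x1 y1 - g x2 y2 - D * ((x1 - x2) +i* (y1 - y2))) <=
    e / 2 * (W + H).
  move=> hx1 hy1 hx2 hy2; have := loc _ _ hx1 hy1; have := loc _ _ hx2 hy2.
  set u := (X in normc X <= _); set v := (X in _ -> normc X <= _ -> _) => hu hv.
  have -> : g x1 y1 - g x2 y2 - D * ((x1 - x2) +i* (y1 - y2)) = v - u.
    have -> : (x1 - x2) +i* (y1 - y2) =
        ((x1 - x) +i* (y1 - y)) - ((x2 - x) +i* (y2 - y)).
      by apply/eqP; rewrite eq_complex/= !opprB !addrA !subrK !eqxx.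
    by rewrite /u /v; ring.
  by apply: le_trans (le_normcD _ _) _; rewrite normcN; lra.
have ix y0 : c <= y0 <= d -> cintegrable a b (g ^~ y0) := holo_rect_intx hr.
have iy x0 : a <= x0 <= b -> cintegrable c d (g x0) := holo_rect_inty hr.
have cc : c <= c <= d by rewrite lexx.
have dd : c <= d <= d by rewrite lexx andbT.
have aa : a <= a <= b by rewrite lexx.
have bb : a <= b <= b by rewrite lexx andbT.
have h1 : normc (cint a b (fun x0 => g x0 c - g x0 d) -
    D * (0 +i* (c - d)) * W%:C) <= 2 * (e / 2 * (W + H) * W).
  apply: cint_near_cst => //; first by apply: complex_integrableB => //; exact: ix.
  by move=> t tab; have := diff t c t d tab cc tab dd; rewrite subrr.
have h2 : normc (cint c d (fun y0 => g b y0 - g a y0) - D * W%:C * H%:C) <=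
    2 * (e / 2 * (W + H) * H).
  apply: cint_near_cst => //; first by apply: complex_integrableB => //; exact: iy.
  by move=> t tcd; have := diff b t a t bb tcd aa tcd; rewrite subrr.
have -> : boundary_int a b c d =
   (cint a b (fun x0 => g x0 c - g x0 d) - D * (0 +i* (c - d)) * W%:C) +
   'i * (cint c d (fun y0 => g b y0 - g a y0) - D * W%:C * H%:C).
  rewrite /boundary_int.
  have -> : 0 +i* (c - d) = - ('i * H%:C).
    apply/eqP; rewrite eq_complex cReN cImN cReM cImM /= /H.
    by apply/andP; split; apply/eqP; ring.
  ring.
apply: le_trans (le_normcD _ _) _.
have ni : normc ('i : C) = 1 by rewrite /normc/= expr0n expr1n add0r sqrtr1.
rewrite normcM ni mul1r; apply: le_trans (lerD h1 h2) _.
by rewrite le_eqVlt; apply/orP; left; apply/eqP; field.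
Qed.

(** The left ends [u n] increase and the right ends [u n + L / 2 ^+ n] decrease, so the supremum of
    the left ends lies in every interval. *)
Lemma nested_point (u : nat -> R) (L : R) :
  (forall n, u n <= u n.+1 <= u n + L / 2 ^+ n.+1) ->
  exists x, forall n, u n <= x <= u n + L / 2 ^+ n.
Proof.
move=> uS.
have up n k : u n <= u (n + k)%N.
  elim: k => [|k IH]; first by rewrite addn0.
  by apply: le_trans IH _; rewrite addnS; case/andP: (uS (n + k)%N).
have down n k : u (n + k)%N + L / 2 ^+ (n + k) <= u n + L / 2 ^+ n.
  elim: k => [|k IH]; first by rewrite addn0.
  apply: le_trans IH; rewrite addnS; case/andP: (uS (n + k)%N) => _ h.
  have -> : L / 2 ^+ (n + k) = L / 2 ^+ (n + k).+1 + L / 2 ^+ (n + k).+1.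
    by rewrite exprS; field; rewrite expf_neq0.
  by rewrite addrA lerD2r.
have L0 n : 0 <= L / 2 ^+ n.
  have /andP[h1 h2] := uS n.
  have : 0 <= L / 2 ^+ n.+1 by lra.
  by rewrite !pmulr_lge0 ?invr_gt0 ?exprn_gt0.
have ub n m : u m <= u n + L / 2 ^+ n.
  have [nm|/ltnW mn] := leqP n m.
    by apply: le_trans (down n (m - n)%N); rewrite subnKC// lerDl.
  by have := up m (n - m)%N; rewrite subnKC// => /le_trans; apply; rewrite lerDl.
exists (sup (range u)) => n; apply/andP; split.
  apply: ub_le_sup; last by exists n.
  by exists (u 0%N + L / 2 ^+ 0) => _ [m _ <-]; exact: ub.
apply: ge_sup; first by exists (u 0%N); exists 0%N.
by move=> _ [m _ <-]; exact: ub.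
Qed.

(** The four quarters add up to the whole, so they cannot all be below a fourth of it. [p] is the
    lower left corner of the quarter that is kept. *)
Lemma goursat_step a b c d : a <= b -> c <= d -> holo_rect a b c d ->
  let L := (b - a) / 2 in let H := (d - c) / 2 in
  exists2 p : R * R, a <= p.1 <= a + L /\ c <= p.2 <= c + H &
  normc (boundary_int a b c d) <=
    4 * normc (boundary_int p.1 (p.1 + L) p.2 (p.2 + H)).
Proof.
move=> ab cd h L H.
have L0 : 0 <= L by rewrite /L; lra.
have H0 : 0 <= H by rewrite /H; lra.
have amb : a <= a + L <= b by rewrite /L; apply/andP; split; lra.
have cmd : c <= c + H <= d by rewrite /H; apply/andP; split; lra.
have bE : b = a + L + L by rewrite /L; lra.
have dE : d = c + H + H by rewrite /H; lra.
have E : boundary_int a b c d =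
    boundary_int a (a + L) c (c + H) + boundary_int a (a + L) (c + H) d +
   (boundary_int (a + L) b c (c + H) + boundary_int (a + L) b (c + H) d).
  case/andP: (amb) => am mb; case/andP: (cmd) => cm md.
  rewrite (boundary_int_splitx cd amb)//; congr (_ + _).
    by apply: boundary_int_splity => //; apply: holo_rectS h.
  by apply: boundary_int_splity => //; apply: holo_rectS h.
apply: contrapT => nh.
have lt p1 p2 : a <= p1 <= a + L -> c <= p2 <= c + H ->
    normc (boundary_int p1 (p1 + L) p2 (p2 + H)) < normc (boundary_int a b c d) / 4.
  move=> h1 h2; rewrite ltNge; apply/negP => h3; apply: nh.
  exists (p1, p2) => /=; first by split.
  by rewrite [leRHS]mulrC -ler_pdivrMr.
have aL : a <= a <= a + L by rewrite lexx lerDl.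
have aL' : a <= a + L <= a + L by rewrite lexx lerDl L0.
have cH : c <= c <= c + H by rewrite lexx lerDl.
have cH' : c <= c + H <= c + H by rewrite lexx lerDl H0.
have := lt _ _ aL cH; have := lt _ _ aL cH'; have := lt _ _ aL' cH.
have := lt _ _ aL' cH'; rewrite -bE -dE => l1 l2 l3 l4.
have : normc (boundary_int a b c d) <= normc (boundary_int a (a + L) c (c + H)) +
   normc (boundary_int a (a + L) (c + H) d) +
   (normc (boundary_int (a + L) b c (c + H)) + normc (boundary_int (a + L) b (c + H) d)).
  rewrite {1}E; apply: le_trans (le_normcD _ _) _.
  by apply: lerD; exact: le_normcD.
lra.
Qed.

Theorem goursat a b c d : a <= b -> c <= d -> holo_rect a b c d ->
  boundary_int a b c d = 0.
Proof.
move=> ab cd h; set L := b - a; set H := d - c.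
have L0 : 0 <= L by rewrite subr_ge0.
have H0 : 0 <= H by rewrite subr_ge0.
pose I n (p : R * R) := boundary_int p.1 (p.1 + L / 2 ^+ n) p.2 (p.2 + H / 2 ^+ n).
pose inside n (p : R * R) := [/\ a <= p.1, p.1 + L / 2 ^+ n <= b,
  c <= p.2 & p.2 + H / 2 ^+ n <= d].
have pos (K : R) n : 0 <= K -> 0 <= K / 2 ^+ n by move=> K0; rewrite divr_ge0// exprn_ge0.
have half (K : R) n : K / 2 ^+ n / 2 = K / 2 ^+ n.+1.
  by rewrite exprS invfM mulrA [in RHS]mulrAC.
have double (K : R) n : K / 2 ^+ n = K / 2 ^+ n.+1 + K / 2 ^+ n.+1.
  by rewrite -half -splitr.
(* The invariant [inside] stands under the existential so that [choice] yields a step function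
   defined on all pairs. *)
have stepex (np : nat * (R * R)) : exists q : R * R, inside np.1 np.2 ->
    [/\ inside np.1.+1 q, np.2.1 <= q.1 <= np.2.1 + L / 2 ^+ np.1.+1,
      np.2.2 <= q.2 <= np.2.2 + H / 2 ^+ np.1.+1 &
      normc (I np.1 np.2) <= 4 * normc (I np.1.+1 q)].
  case: np => n [p1 p2] /=.
  have [[/= p1a p1b p2c p2d]|ni] := pselect (inside n (p1, p2)); last first.
    by exists (p1, p2).
  have hr : holo_rect p1 (p1 + L / 2 ^+ n) p2 (p2 + H / 2 ^+ n).
    exact: holo_rectS h.
  have := goursat_step _ _ hr; rewrite !lerDl => /(_ (pos _ _ L0) (pos _ _ H0)).
  rewrite !(addrC _ (- p1)) !(addrC _ (- p2)) !addKr !half.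
  move=> [[q1 q2] /= [hq1 hq2] hq]; exists (q1, q2) => _; split => //.
  have /andP[q1a q1b] := hq1; have /andP[q2c q2d] := hq2.
  have := double L n; have := double H n => dH dL.
  by split => /=; lra.
have [F HF] := choice stepex.
pose s := fix s n := if n is m.+1 then F (m, s m) else (a, c).
have ins n : inside n (s n).
  elim: n => [|n IH]; last by have [] := HF (n, s n) IH.
  by split; rewrite /= ?lexx// expr0 invr1 mulr1 /L /H; lra.
have [|x hx] := @nested_point (fun n => (s n).1) L.
  by move=> n; have [] := HF (n, s n) (ins n).
have [|y hy] := @nested_point (fun n => (s n).2) H.
  by move=> n; have [] := HF (n, s n) (ins n).
have I4 n : normc (boundary_int a b c d) <= 4 ^+ n * normc (I n (s n)).
  elim: n => [|n IH].
    rewrite /I /= !expr0 !invr1 !mulr1 mul1r /L /H.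
    by rewrite [a + _]addrC subrK [c + _]addrC subrK.
  apply: le_trans IH _; rewrite exprSr -mulrA ler_pM2l ?exprn_gt0//.
  by have [] := HF (n, s n) (ins n).
have xab : a <= x <= b.
  have := hx 0%N; have := ins 0%N; rewrite /inside expr0 invr1 !mulr1 /=.
  by move=> [? ? ? ?] /andP[? ?]; apply/andP; split => //; lra.
have ycd : c <= y <= d.
  have := hy 0%N; have := ins 0%N; rewrite /inside expr0 invr1 !mulr1 /=.
  by move=> [? ? ? ?] /andP[? ?]; apply/andP; split => //; lra.
apply/eqP; rewrite -normc_eq0 eq_le normc_ge0 andbT.
apply/ler_addgt0Pr => e e0; rewrite add0r.
(* The local estimate on the n-th rectangle carries ((L + H) / 2^n)^2, which exactly absorbs the
   factor 4^n of [I4]. The [+ 1] keeps the denominator positive when the rectangle is a point. *)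
have K0 : 0 < (L + H) ^+ 2 + 1 by rewrite ltr_wpDl// sqr_ge0.
have e'0 : 0 < e / ((L + H) ^+ 2 + 1) by rewrite divr_gt0.
have [de de0 small] := boundary_int_small (h x y xab ycd) e'0.
have tiny (K : R) : 0 <= K -> \forall n \near \oo, K / 2 ^+ n < de.
  move=> K0'.
  have : (fun n => K * (2^-1) ^+ n) @ \oo --> K * 0.
    apply: cvgMr; apply: cvg_expr.
    by rewrite ger0_norm// invf_lt1// ltr1n.
  rewrite mulr0 => /cvgrPdist_lt/(_ _ de0); apply: filterS => n.
  rewrite sub0r normrN ger0_norm ?exprVn//.
  by rewrite mulr_ge0// invr_ge0 exprn_ge0.
have [n [nL nH]] : exists n, L / 2 ^+ n < de /\ H / 2 ^+ n < de.
  near \oo => n; exists n; split; near: n; exact: tiny.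
have [? ? ? ?] := ins n.
have := small (s n).1 ((s n).1 + L / 2 ^+ n) (s n).2 ((s n).2 + H / 2 ^+ n) (hx n) (hy n).
rewrite !(addrC _ (- (s n).1)) !(addrC _ (- (s n).2)) !addKr => /(_ nL nH).
have hr : holo_rect (s n).1 ((s n).1 + L / 2 ^+ n) (s n).2 ((s n).2 + H / 2 ^+ n).
  exact: holo_rectS h.
move=> /(_ hr) {}small; apply: le_trans (I4 n) _.
apply: (@le_trans _ _ (4 ^+ n * (e / ((L + H) ^+ 2 + 1) *
    (L / 2 ^+ n + H / 2 ^+ n) ^+ 2))).
  by rewrite ler_pM2l ?exprn_gt0.
have -> : 4 ^+ n * (e / ((L + H) ^+ 2 + 1) * (L / 2 ^+ n + H / 2 ^+ n) ^+ 2) =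
    e / ((L + H) ^+ 2 + 1) * (L + H) ^+ 2.
  have -> : 4 ^+ n = (2 ^+ n) ^+ 2 :> R.
    by rewrite -exprM mulnC exprM; congr (_ ^+ _); rewrite -natrX.
  by field; rewrite expf_neq0 ?gt_eqF.
by rewrite mulrAC ler_pdivrMr// ler_pM2l// lerDl.
Unshelve. all: by end_near. Qed.

End goursat.

(** * Circle means and Cauchy's formula *)

Section polar.
Variable R : realType.
Local Notation C := R[i].
Implicit Types (r u t : R) (h f : C -> C^o).

Definition circ r t : C := (r * cos t) +i* (r * sin t).

Lemma normc_circ r t : normc (circ r t) = `|r|.
Proof.
rewrite /circ /normc/= !exprMn -mulrDr cos2Dsin2 mulr1.
by rewrite sqrtr_sqr.
Qed.

Lemma derive_eps (k : R -> R) (x d e : R) : is_derive x 1 k d -> 0 < e ->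
  exists2 de : R, 0 < de & forall y, `|y - x| < de ->
    `|k y - k x - d * (y - x)| <= e * `|y - x|.
Proof.
move=> kd e0; have := @ex_derive _ _ _ _ _ _ _ kd.
move=> /derivable_nbhsP/=.
move: kd => [] + <- _; rewrite /derivable => /cvgrPdist_le/(_ _ e0).
rewrite near_withinE => /nbhs_ballP[de /= de0 h]; exists de => // y yx.
have [->|yx0] := eqVneq y x; first by rewrite !subrr mulr0 subrr normr0 mulr0.
have := h (y - x); rewrite /ball/= sub0r normrN subr_eq0 yx0 => /(_ yx isT).
have yx1 : y - x != 0 by rewrite subr_eq0.
rewrite /GRing.scale/= mulr1 subrK.
set dd := lim _ => {}h.
have -> : k y - k x - dd * (y - x) = - (y - x) * (dd - (y - x)^-1 * (k y - k x)).
  by field.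
by rewrite normrM normrN mulrC ler_wpM2r.
Qed.

(** [circ (expR a) b] is exp(a + ib); this is its derivative at 0, assembled from those of exp, cos
    and sin. *)
Lemma circ_exp_expand (e : R) : 0 < e -> exists2 de : R, 0 < de &
  forall a b : R, `|a| < de -> `|b| < de ->
    normc (circ (expR a) b - 1 - (a +i* b)) <= e * (`|a| + `|b|).
Proof.
move=> e0; have e4 : 0 < Num.min (e / 8) 1 by rewrite lt_min ltr01 andbT; lra.
have [d1 d10 h1] := derive_eps (is_derive_expR (0 : R)) e4.
have [d2 d20 h2] := derive_eps (is_derive_cos (0 : R)) e4.
have [d3 d30 h3] := derive_eps (is_derive_sin (0 : R)) e4.
exists (Num.min (Num.min d1 d2) (Num.min d3 (Num.min (e / 8) 1))).
  by rewrite !lt_min d10 d20 d30 ltr01 andbT; lra.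
move=> a b; rewrite !lt_min => /andP[/andP[a1 a2] /andP[a3 /andP[a4 a5]]].
move=> /andP[/andP[b1 b2] /andP[b3 /andP[b4 b5]]].
have := h1 a; have := h2 b; have := h3 b; rewrite !subr0.
move=> /(_ b3) + /(_ b2) + /(_ a1).
rewrite expR0 cos0 sin0 !mul1r mulNr mul0r opprK addr0 !subr0 => hs hc he.
have a0 := normr_ge0 a; have b0 := normr_ge0 b.
have le8 : Num.min (e / 8) 1 <= e / 8 by rewrite ge_min lexx.
have le1 : Num.min (e / 8) 1 <= 1 by rewrite ge_min lexx orbT.
have he8 : `|expR a - 1 - a| <= e / 8 * `|a|.
  by apply: le_trans he _; exact: ler_wpM2r.
have he1 : `|expR a - 1| <= 2 * `|a|.
  rewrite -[expR a - 1](subrK a); apply: le_trans (ler_normD _ _) _.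
  rewrite mulr2n mulrDl mul1r lerD2r; apply: le_trans he _.
  by rewrite -[leRHS]mul1r; exact: ler_wpM2r.
have hc8 : `|cos b - 1| <= e / 8 * `|b|.
  by apply: le_trans hc _; exact: ler_wpM2r.
have hs8 : `|sin b - b| <= e / 8 * `|b|.
  by apply: le_trans hs _; exact: ler_wpM2r.
have hs1 : `|sin b| <= 2 * `|b|.
  rewrite -[sin b](subrK b); apply: le_trans (ler_normD _ _) _.
  rewrite mulr2n mulrDl mul1r lerD2r; apply: le_trans hs _.
  by rewrite -[leRHS]mul1r; exact: ler_wpM2r.
have cb1 : `|cos b| <= 1 by rewrite ler_norml cos_geN1 cos_le1.
have hRe : `|expR a * cos b - 1 - a| <= e / 8 * `|a| + 2 * (e / 8 * `|b|).
  have -> : expR a * cos b - 1 - a =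
    (expR a - 1 - a) * cos b + (1 + a) * (cos b - 1) by ring.
  apply: le_trans (ler_normD _ _) _; rewrite !normrM; apply: lerD.
    by apply: le_trans he8; rewrite ler_piMr.
  by apply: ler_pM => //; apply: le_trans (ler_normD _ _) _; rewrite normr1; lra.
have hIm : `|expR a * sin b - b| <= e / 8 * `|b| + e / 4 * (2 * `|b|).
  have -> : expR a * sin b - b = (sin b - b) + (expR a - 1) * sin b by ring.
  apply: le_trans (ler_normD _ _) _; rewrite normrM lerD// ler_pM//.
  by apply: le_trans he1 _; lra.
apply: le_trans (normc_le_ReIm _) _; rewrite /= subr0; apply: le_trans (lerD hRe hIm) _.
nra.
Qed.

Lemma circ_expD a b u t :
  circ (expR (a + u)) (b + t) = circ (expR a) b * circ (expR u) t.
Proof.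
apply/eqP; rewrite eq_complex cReM cImM /= expRD cosD sinD.
by apply/andP; split; apply/eqP; ring.
Qed.

Lemma gderiv_circ_exp u t :
  gderiv (fun u t => circ (expR u) t) u t (circ (expR u) t).
Proof.
move=> e e0; have N0 : 0 < normc (circ (expR u) t).
  by rewrite normc_circ normr_gt0 gt_eqF ?expR_gt0.
have e'0 : 0 < e / normc (circ (expR u) t) by rewrite divr_gt0.
have [de de0 h] := circ_exp_expand e'0; exists de => // u' t' hu ht.
have {1}-> : u' = u + (u' - u) by rewrite addrC subrK.
have {1}-> : t' = t + (t' - t) by rewrite addrC subrK.
rewrite circ_expD -{2}[circ (expR u) t]mulr1 -!mulrBr normcM.
by rewrite mulrC -ler_pdivlMr// mulrAC h.
Qed.

Lemma gderiv_comp (g : R -> R -> C) h u t D d : gderiv g u t D ->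
  cderiv h (g u t) d -> gderiv (fun u t => h (g u t)) u t (d * D).
Proof.
move=> gD hd e e0.
have D0 := normc_ge0 D; have d0 := normc_ge0 d.
have K0 : 0 < normc D + 2 by lra.
have K1 : 0 < normc d + 1 by lra.
have e1 : 0 < e / 2 / (normc D + 2) by rewrite !divr_gt0.
have e2 : 0 < Num.min 1 (e / 2 / (normc d + 1)) by rewrite lt_min ltr01 !divr_gt0.
have [d1 d10 h1] := hd _ e1; have [d2 d20 h2] := gD _ e2.
have d12 : 0 < d1 / 2 by rewrite divr_gt0.
have [d3 d30 h3] := gderiv_cont gD d12.
exists (Num.min d2 d3); first by rewrite lt_min d20.
move=> u' t'; rewrite !lt_min => /andP[u2 u3] /andP[t2 t3].
have := h2 _ _ u2 t2; have := h3 _ _ u3 t3.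
set s := `|u' - u| + `|t' - t|; set w := _ +i* _; set q := g u' t' - g u t => hq hqD.
have s0 : 0 <= s by rewrite addr_ge0.
have ws : normc w <= s := normc_pair _ _.
have qd1 : normc q < d1 by apply: le_lt_trans hq _; lra.
have := h1 (g u' t') qd1; rewrite -/q => hh.
have nqD : normc (q - D * w) <= s.
  apply: le_trans hqD _; rewrite -[leRHS]mul1r ler_wpM2r//.
  by rewrite ge_min lexx.
have nq : normc q <= (normc D + 2) * s.
  rewrite -(subrK (D * w) q); apply: le_trans (le_normcD _ _) _.
  rewrite normcM; have : normc D * normc w <= normc D * s by rewrite ler_wpM2l.
  lra.
have -> : h (g u' t') - h (g u t) - d * D * w =
  (h (g u' t') - h (g u t) - d * q) + d * (q - D * w) by ring.
apply: le_trans (le_normcD _ _) _; rewrite [e]splitr mulrDl lerD//.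
  apply: le_trans hh _; apply: le_trans (ler_wpM2l (ltW e1) nq) _.
  by rewrite mulrA divfK ?gt_eqF.
rewrite normcM.
apply: (@le_trans _ _ ((normc d + 1) * (e / 2 / (normc d + 1) * s))).
  apply: ler_pM; rewrite ?normc_ge0//; first lra.
  by apply: le_trans hqD _; rewrite ler_wpM2r// ge_min lexx orbT.
by rewrite mulrA [X in X * s]mulrC divfK ?gt_eqF.
Qed.

(** Not divided by 2 pi. It is the integral of h(w) dw / (iw) over the circle, which is why the
    kernels below carry an extra factor w. *)
Definition cmean h r : C := cint 0 (2 * pi) (fun t => h (circ r t)).

Lemma circ_lip r r' t t' : normc (circ r' t' - circ r t) <=
  2 * `|r' - r| + `|r| * (`|cos t' - cos t| + `|sin t' - sin t|).
Proof.
apply: le_trans (normc_le_ReIm _) _.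
rewrite cReD cReN cImD cImN /=.
have -> : r' * cos t' - r * cos t = (r' - r) * cos t' + r * (cos t' - cos t) by ring.
have -> : r' * sin t' - r * sin t = (r' - r) * sin t' + r * (sin t' - sin t) by ring.
have hc : `|(r' - r) * cos t'| <= `|r' - r|.
  by rewrite normrM ler_piMr// ler_norml cos_geN1 cos_le1.
have hs : `|(r' - r) * sin t'| <= `|r' - r|.
  by rewrite normrM ler_piMr// ler_norml sin_geN1 sin_le1.
have := ler_normD ((r' - r) * cos t') (r * (cos t' - cos t)).
have := ler_normD ((r' - r) * sin t') (r * (sin t' - sin t)).
rewrite [`|r * (cos t' - cos t)|]normrM [`|r * (sin t' - sin t)|]normrM mulrDr.
lra.
Qed.

Lemma circ_near r t (de : R) : 0 < de ->
  \forall t' \near t & r' \near r, normc (circ r' t' - circ r t) < de.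
Proof.
move=> de0; have r1 : 0 < `|r| + 1 by rewrite ltr_wpDl.
have e8 : 0 < de / 8 by lra.
have e9 : 0 < de / 8 / (`|r| + 1) by rewrite divr_gt0.
have hc : \forall t' \near t, `|cos t - cos t'| < de / 8 / (`|r| + 1).
  by have /cvgrPdist_lt/(_ _ e9) := @continuous_cos R t.
have hs : \forall t' \near t, `|sin t - sin t'| < de / 8 / (`|r| + 1).
  by have /cvgrPdist_lt/(_ _ e9) := @continuous_sin R t.
near=> t' r'.
have : `|cos t - cos t'| < de / 8 / (`|r| + 1) by near: t'.
have : `|sin t - sin t'| < de / 8 / (`|r| + 1) by near: t'.
have : `|r - r'| < de / 8 by near: r'; exact: cvgr_dist_lt.
rewrite distrC (distrC (sin t)) (distrC (cos t)) !ltr_pdivlMr// => hr h1 h2.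
apply: le_lt_trans (circ_lip _ _ _ _) _.
have : `|r| * (`|cos t' - cos t| + `|sin t' - sin t|) <=
  (`|r| + 1) * (`|cos t' - cos t| + `|sin t' - sin t|).
  by rewrite ler_wpM2r ?addr_ge0// lerDl.
lra.
Unshelve. all: by end_near. Qed.

Lemma circ_path_cont h r t : ccont h (circ r t) -> path_cont (fun t => h (circ r t)) t.
Proof.
move=> ch e e0; have [de de0 hde] := ch _ e0.
have [[A B] /= [tA rB] AB] := circ_near r t de0.
have /nbhs_ballP[d /= d0 dA] := tA.
exists d => // t' t't; apply: hde; apply: (AB (t', r)); split => /=.
  by apply: dA; rewrite /ball/= distrC.
exact: nbhs_singleton rB.
Qed.

Lemma circ_integrable h r : (forall w, normc w = `|r| -> exists d, cderiv h w d) ->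
  cintegrable 0 (2 * pi) (fun t => h (circ r t)).
Proof.
move=> hd; apply: path_cont_integrable => t _; apply: circ_path_cont.
by have [d] := hd _ (normc_circ r t); exact: cderiv_ccont.
Qed.

Lemma pi2_ge0 : 0 <= 2 * pi :> R.
Proof. by rewrite mulr_ge0// pi_ge0. Qed.

(** Under w = exp(u + it) the annulus is the image of a rectangle of height 2 pi. The horizontal
    sides cancel by periodicity, and the vertical ones are the two circle means. *)
Lemma cmean_const h r1 r2 : 0 < r1 <= r2 ->
  (forall w, r1 <= normc w <= r2 -> exists d, cderiv h w d) ->
  cmean h r1 = cmean h r2.
Proof.
move=> /andP[r10 r12] hd; have r20 := lt_le_trans r10 r12.
pose g u t := h (circ (expR u) t).
have ln12 : ln r1 <= ln r2 by rewrite ler_ln.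
have hr : holo_rect g (ln r1) (ln r2) 0 (2 * pi).
  move=> u t /andP[u1 u2] _; have [|d hdw] := hd (circ (expR u) t).
    rewrite normc_circ ger0_norm ?expR_ge0//.
    by rewrite -[r1]lnK// -[r2]lnK// !ler_expR u1.
  by exists (d * circ (expR u) t); exact: (gderiv_comp (gderiv_circ_exp u t) hdw).
have := goursat ln12 pi2_ge0 hr; rewrite /boundary_int.
have -> : (fun x => g x 0 - g x (2 * pi)) = fun=> 0.
  apply/funext => x; rewrite /g /circ.
  by rewrite mulr_natl -[pi *+ 2]add0r cosD2pi sinD2pi subrr.
rewrite cint_cst// mul0r add0r => /eqP; rewrite mulf_eq0 => /orP[|].
  by rewrite eq_complex/= oner_eq0 andbF.
rewrite /cint complex_integralB//; first last.
- by apply: (holo_rect_inty hr); rewrite lexx.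
- by apply: (holo_rect_inty hr); rewrite lexx andbT.
by rewrite subr_eq0 => /eqP; rewrite /g !lnK.
Qed.

(** Bridges the radii at which [cmean_const] fails, namely 0 and the modulus of a singular point.
    Compactness of [[0, 2 * pi]] makes closeness in the radius uniform in the angle; length 2 pi and
    the factor 2 of [normc_cint_le] explain [4 * pi]. *)
Lemma cmean_cont h r : (forall w, ccont h w) -> path_cont (cmean h) r.
Proof.
move=> ch e e0.
have p0 : 0 < pi :> R := pi_gt0 R.
have e'0 : 0 < e / (4 * pi) by rewrite divr_gt0// mulr_gt0.
have := @segment_compact R 0 (2 * pi).
move=> /compact_near_coveringP/(_ R (nbhs r)
  (fun r' t => normc (h (circ r' t) - h (circ r t)) <= e / (4 * pi))).
case=> [t _|d /= d0 hnear].
  have e'2 : 0 < e / (4 * pi) / 2 by rewrite divr_gt0.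
  have [de de0 hde] := ch (circ r t) _ e'2.
  have near1 := circ_near r t de0.
  have near2 : \forall t' \near t & r' \near r, normc (circ r t' - circ r t) < de.
    have [[A B] /= [tA rB] AB] := near1; exists (A, B) => //= -[t' r'] /= [At' _].
    by apply: (AB (t', r)); split => //=; exact: nbhs_singleton rB.
  apply: filterS2 near1 near2 => -[t' r'] h1 h2; rewrite /fst /snd.
  have := hde (circ r' t') h1; have := hde (circ r t') h2 => k1 k2.
  have -> : h (circ r' t') - h (circ r t') =
    (h (circ r' t') - h (circ r t)) - (h (circ r t') - h (circ r t)) by ring.
  by apply: le_trans (le_normcD _ _) _; rewrite normcN; lra.
exists d => // r' r'r; rewrite -[cmean h r' - _]complex_integralB//; last 2 first.
- by apply: path_cont_integrable => t _; exact: circ_path_cont.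
- by apply: path_cont_integrable => t _; exact: circ_path_cont.
have hr' : forall t, 0 <= t <= 2 * pi ->
    normc (h (circ r' t) - h (circ r t)) <= e / (4 * pi).
  move=> t t02; have := hnear r'; rewrite /ball/= distrC => /(_ r'r t).
  by apply; rewrite /= in_itv/=.
apply: le_trans (normc_cint_le pi2_ge0 _ hr') _.
  apply: complex_integrableB => //;
    by apply: path_cont_integrable => t _; exact: circ_path_cont.
have E (p : R) : p != 0 -> 2 * (e / (4 * p) * (2 * p)) = e by move=> ?; field.
by rewrite subr0 E// lt0r_neq0.
Qed.

Lemma path_cont_const_right (K : R -> C) a b : a < b -> path_cont K a ->
  (forall x, a < x <= b -> K x = K b) -> K a = K b.
Proof.
move=> ab Ka Kb; apply/eqP; rewrite -subr_eq0 -normc_eq0 eq_le normc_ge0 andbT.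
apply/ler_addgt0Pr => e e0; rewrite add0r normcB.
have [de de0 h] := Ka _ e0; pose x := Num.min b (a + de / 2).
have ax : a < x by rewrite lt_min ab; lra.
have xb : x <= b by rewrite ge_min lexx.
have xa : x <= a + de / 2 by rewrite ge_min lexx orbT.
by rewrite -(Kb x) ?ax//; apply: h; rewrite gtr0_norm; lra.
Qed.

Lemma path_cont_const_left (K : R -> C) a b : a < b -> path_cont K b ->
  (forall x, a <= x < b -> K x = K a) -> K b = K a.
Proof.
move=> ab Kb Ka; apply/eqP; rewrite -subr_eq0 -normc_eq0 eq_le normc_ge0 andbT.
apply/ler_addgt0Pr => e e0; rewrite add0r normcB.
have [de de0 h] := Kb _ e0; pose x := Num.max a (b - de / 2).
have xb : x < b by rewrite gt_max ab; lra.
have ax : a <= x by rewrite le_max lexx.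
have xd : b - de / 2 <= x by rewrite le_max lexx orbT.
by rewrite -(Ka x) ?ax//; apply: h; rewrite ltr0_norm; lra.
Qed.

End polar.

Section cauchy.
Variable R : realType.
Local Notation C := R[i].
Implicit Types (r : R) (z w : C) (f g h : C -> C^o).

Lemma eq_cderiv f g z d (e : R) : 0 < e ->
  (forall w, normc (w - z) < e -> f w = g w) -> cderiv f z d -> cderiv g z d.
Proof.
move=> e0 fg fd k k0; have [de de0 h] := fd k k0.
exists (Num.min de e); first by rewrite lt_min de0.
move=> w; rewrite lt_min => /andP[wde we].
by rewrite -!fg ?h// subrr normc0.
Qed.

Lemma derivable_kernel z w : w != z ->
  derivable ((fun w => w / (w - z)) : C^o -> C^o) w 1.
Proof.
move=> wz; apply: derivableM; first exact: derivable_id.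
apply: derivableV; first by rewrite subr_eq0.
by apply: derivableB; [exact: derivable_id|exact: derivable_cst].
Qed.

Lemma cint_eq a b (phi psi : R -> C) :
  (forall t, a <= t <= b -> phi t = psi t) -> cint a b phi = cint a b psi.
Proof.
by move=> h; apply: eq_complex_integral => t; rewrite inE/= in_itv/=; exact: h.
Qed.

Lemma circ_neq z r t : normc z < r -> circ r t != z.
Proof.
move=> zr; apply/eqP => cz; have := normc_circ r t.
rewrite cz gtr0_norm; first by move=> e; rewrite e ltxx in zr.
exact: le_lt_trans (normc_ge0 z) zr.
Qed.

(** The mean is the same for all radii above |z|, and the kernel tends to 1 as the radius grows. *)
Lemma cmean_kernel z r : normc z < r ->
  cmean (fun w => w / (w - z)) r = (2 * pi)%:C.
Proof.
move=> zr; have z0 := normc_ge0 z; have r0 := le_lt_trans z0 zr.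
have kd w : normc z < normc w -> exists d, cderiv (fun w => w / (w - z)) w d.
  move=> zw; apply: derivable_cderiv; apply: derivable_kernel.
  by apply/eqP => wz; rewrite wz ltxx in zw.
apply/eqP; rewrite -subr_eq0 -normc_eq0 eq_le normc_ge0 andbT.
apply/ler_addgt0Pr => e e0; rewrite add0r.
pose K : R := 2 * (2 * pi).
have p0 : 0 < pi :> R := pi_gt0 R.
have K0 : 0 < K by rewrite /K !mulr_gt0.
(* On this circle the kernel is within |z| / (r' - |z|) of 1, which integrates to less than e after
   multiplication by K. *)
pose r' := Num.max r (normc z + normc z * K / e + 1).
have rr' : r <= r' by rewrite le_max lexx.
have zr' : normc z * K / e < r' - normc z.
  have : normc z + normc z * K / e + 1 <= r' by rewrite le_max lexx orbT.
  lra.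
have zr'0 : normc z < r' := lt_le_trans zr rr'.
have r'0 := lt_le_trans r0 rr'.
rewrite (@cmean_const _ _ r r') ?r0//; last first.
  by move=> w /andP[rw _]; apply: kd; exact: lt_le_trans rw.
have := @cint_near_cst _ 0 (2 * pi) (fun t => circ r' t / (circ r' t - z)) 1
  (normc z / (r' - normc z)) (pi2_ge0 R).
rewrite subr0 mul1r => near1; apply: le_trans (near1 _ _) _.
- apply: (@circ_integrable _ (fun w => w / (w - z))) => w wr; apply: kd.
  by rewrite wr gtr0_norm.
- move=> t _; have cz : circ r' t - z != 0 by rewrite subr_eq0 circ_neq.
  have -> : circ r' t / (circ r' t - z) - 1 = z / (circ r' t - z) by field.
  rewrite normc_div ler_wpM2l// lef_pV2 ?posrE ?subr_gt0//; last first.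
    by rewrite normc_gt0.
  by apply: le_trans (le_normcB _ _); rewrite normc_circ gtr0_norm.
rewrite mulrCA -/K mulrAC ler_pdivrMr ?subr_gt0//.
by rewrite [leRHS]mulrC -ler_pdivrMr// ltW.
Qed.

Variable f : C -> C^o.
Hypothesis ef : entire f.

Lemma entire_cderiv z : exists d, cderiv f z d.
Proof. by apply: derivable_cderiv; exact: ef. Qed.

(* The mean over |w| = s of [w (f w - f z) / (w - z)] does not depend on s off
   s = |z|, and it is continuous in s and zero at s = 0. *)
Lemma cmean_quotient z r : normc z < r ->
  cmean (fun w => w * (f w - f z) / (w - z)) r = 0.
Proof.
move=> zr; have [d fd] := entire_cderiv z.
(* z * d is the limit at z, so [h] is continuous everywhere and differentiable off z; no removable
   singularity theorem enters. *)
pose h w := if w == z then z * d else w * (f w - f z) / (w - z).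
have hq w : w != z -> h w = w * (f w - f z) / (w - z) by rewrite /h => /negbTE->.
have hd w : w != z -> exists d, cderiv h w d.
  move=> wz.
  have dq : derivable ((fun w => w * (f w - f z) / (w - z)) : C^o -> C^o) w 1.
    apply: derivableM; last first.
      apply: derivableV; first by rewrite subr_eq0.
      by apply: derivableB; [exact: derivable_id|exact: derivable_cst].
    apply: derivableM; first exact: derivable_id.
    by apply: derivableB; [exact: ef|exact: derivable_cst].
  have [d' hd'] := derivable_cderiv dq; exists d'.
  have wz0 : 0 < normc (w - z) by rewrite normc_gt0 subr_eq0.
  apply: eq_cderiv wz0 _ hd' => w' w'w; rewrite hq//.
  by apply/eqP => w'z; rewrite w'z normcB ltxx in w'w.
have hz : ccont h z.
  move=> e e0; have z1 : 0 < normc z + 1 by rewrite ltr_wpDl ?normc_ge0.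
  have d1 : 0 < normc d + 1 by rewrite ltr_wpDl ?normc_ge0.
  have e1 : 0 < e / 2 / (normc z + 1) by rewrite !divr_gt0.
  have e2 : 0 < e / 2 / (normc d + 1) by rewrite !divr_gt0.
  have [de de0 hde] := fd _ e1.
  exists (Num.min (Num.min de 1) (e / 2 / (normc d + 1))).
    by rewrite !lt_min de0 ltr01.
  move=> w; rewrite !lt_min => /andP[/andP[wde w1]]; rewrite ltr_pdivlMr// => we.
  have [->|wz] := eqVneq w z; first by rewrite subrr normc0 ltW.
  rewrite hq// {1}/h eqxx.
  have wz0 : w - z != 0 by rewrite subr_eq0.
  have -> : w * (f w - f z) / (w - z) - z * d =
    w * ((f w - f z - d * (w - z)) / (w - z)) + (w - z) * d by field.
  apply: le_trans (le_normcD _ _) _; rewrite [e]splitr lerD//.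
    rewrite normcM normc_div mulrC.
    have q : normc (f w - f z - d * (w - z)) / normc (w - z) <= e / 2 / (normc z + 1).
      by rewrite ler_pdivrMr ?normc_gt0// hde.
    have w2 : normc w <= normc z + 1.
      by have := le_normcB w z; lra.
    apply: le_trans (ler_pM _ _ q w2) _; rewrite ?normc_ge0//.
      by rewrite divr_ge0 ?normc_ge0.
    by rewrite divfK// gt_eqF.
  rewrite normcM; apply: le_trans (ltW we); rewrite ler_wpM2l ?normc_ge0//.
  by rewrite lerDl.
have hc w : ccont h w.
  have [->//|/hd[d']] := eqVneq w z; exact: cderiv_ccont.
have K0 : cmean h 0 = 0.
  rewrite /cmean; have -> : (fun t => h (circ 0 t)) = fun=> h 0.
    by apply/funext => t; rewrite /circ !mul0r.
  rewrite cint_cst ?pi2_ge0// /h.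
  by case: ifP => [/eqP <-|_]; rewrite !mul0r.
have z0 := normc_ge0 z; have r0 := le_lt_trans z0 zr.
have Kz : cmean h (normc z) = 0.
  have [->//|zn0] := eqVneq (normc z) 0.
  have {zn0}z0 : 0 < normc z by rewrite lt_neqAle eq_sym zn0.
  have z2 : 0 < normc z / 2 by rewrite divr_gt0.
  have z2z : normc z / 2 < normc z by lra.
  have inner s s' : 0 < s -> s <= s' -> s' < normc z -> cmean h s = cmean h s'.
    move=> s0 ss' s'z; apply: cmean_const; first by rewrite s0.
    move=> w /andP[_ ws']; apply: hd; apply/eqP => wz.
    by have := le_lt_trans ws' s'z; rewrite wz ltxx.
  rewrite (path_cont_const_left z2z (cmean_cont _ hc)); last first.
    by move=> x /andP[zx xz]; rewrite -(inner (normc z / 2) x).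
  rewrite -(path_cont_const_right z2 (cmean_cont _ hc))//.
  by move=> x /andP[x0 xz]; exact: inner.
have <- : cmean h r = 0.
  rewrite -(path_cont_const_right zr (cmean_cont _ hc))//.
  move=> x /andP[zx xr]; apply: cmean_const; first by rewrite (le_lt_trans z0 zx).
  move=> w /andP[xw _]; apply: hd; apply/eqP => wz.
  by have := lt_le_trans zx xw; rewrite wz ltxx.
by apply: cint_eq => t _; rewrite hq// circ_neq.
Qed.

(** Write f w = (f w - f z) + f z: the first part has mean 0 by [cmean_quotient], and the second is
    f z times [cmean_kernel]. *)
Lemma cauchy_formula z r : normc z < r ->
  cmean (fun w => f w * (w / (w - z))) r = (2 * pi)%:C * f z.
Proof.
move=> zr; have r0 : 0 < r := le_lt_trans (normc_ge0 z) zr.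
have nz w : normc w = `|r| -> w != z.
  by rewrite gtr0_norm// => wr; apply/eqP => wz; rewrite -wr wz ltxx in zr.
have ik : cintegrable 0 (2 * pi) (fun t => circ r t / (circ r t - z)).
  apply: (@circ_integrable _ (fun w => w / (w - z))) => w /nz wz.
  exact/derivable_cderiv/derivable_kernel.
have ifk : cintegrable 0 (2 * pi) (fun t => f (circ r t) * (circ r t / (circ r t - z))).
  apply: (@circ_integrable _ (fun w => f w * (w / (w - z)))) => w /nz wz.
  by apply: derivable_cderiv; apply: derivableM; [exact: ef|exact: derivable_kernel].
have fik := complex_integrableZ (measurable_itv `[0, (2 * pi)]) (f z) ik.
rewrite [RHS]mulrC -(cmean_kernel zr); apply/eqP; rewrite -subr_eq0; apply/eqP.
rewrite -(complex_integralZ (measurable_itv `[0, (2 * pi)]) (f z) ik).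
rewrite -(complex_integralB (measurable_itv `[0, (2 * pi)]) ifk fik).
rewrite -(cmean_quotient zr); apply: cint_eq => t _.
by ring.
Qed.

(* [d] is f'(z); only the existence of some [d] with these bounds is needed. *)
Lemma entire_taylor2 z rho M : 0 < rho -> normc z <= rho ->
  (forall w, normc w = 2 * rho -> normc (f w) <= M) ->
  exists2 d, normc d <= 4 * M / rho & forall z', normc z' <= rho ->
    normc (f z' - f z - d * (z' - z)) <= 4 * M / rho ^+ 2 * normc (z' - z) ^+ 2.
Proof.
move=> rho0 zrho; have [r rE] : exists r, r = 2 * rho by exists (2 * rho).
rewrite -rE => fM; have r0 : 0 < r by rewrite rE mulr_gt0.
have far z0 : normc z0 <= rho -> normc z0 < r by rewrite rE; lra.
have nz z0 w : normc z0 <= rho -> normc w = `|r| -> w != z0.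
  move=> /far zr; rewrite gtr0_norm// => wr; apply/eqP => wz.
  by rewrite -wr wz ltxx in zr.
have p0 : 0 < pi :> R := pi_gt0 R.
have pi0 : (2 * pi)%:C != 0 :> C.
  by rewrite -normc_eq0 normc_real normr_eq0 mulf_neq0// gt_eqF.
have M0 : 0 <= M.
  by apply: le_trans (normc_ge0 _) (fM (circ r 0) _); rewrite normc_circ gtr0_norm.
(* The circle of radius 2 rho is at distance at least rho from every point of the disc. Its radius
   in the numerators and the factor 2 for complex integrals produce the constant 4. *)
have dist z0 t : normc z0 <= rho -> rho <= normc (circ r t - z0).
  move=> zr; apply: le_trans (le_normcB _ _); rewrite normc_circ gtr0_norm// rE.
  lra.
have dk z0 w : w != z0 -> derivable ((fun w => f w * (w / (w - z0))) : C^o -> C^o) w 1.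
  by move=> wz; apply: derivableM; [exact: ef|exact: derivable_kernel].
have ik z0 : normc z0 <= rho ->
    cintegrable 0 (2 * pi) (fun t => f (circ r t) * (circ r t / (circ r t - z0))).
  move=> zr; apply: (@circ_integrable _ (fun w => f w * (w / (w - z0)))) => w wr.
  exact/derivable_cderiv/dk/nz.
(* Derivative in z of the Cauchy integrand. *)
pose k2 t := f (circ r t) * (circ r t / (circ r t - z)) / (circ r t - z).
have ik2 : cintegrable 0 (2 * pi) k2.
  apply: (@circ_integrable _ (fun w => f w * (w / (w - z)) / (w - z))) => w wr.
  have wz := nz _ _ zrho wr; apply: derivable_cderiv; apply: derivableM; first exact: dk.
  apply: derivableV; first by rewrite subr_eq0.
  by apply: derivableB; [exact: derivable_id|exact: derivable_cst].
have scale (I : C) (X : R) : normc I <= 2 * (X * (2 * pi)) ->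
    normc (I / (2 * pi)%:C) <= 2 * X.
  rewrite normc_div normc_real gtr0_norm ?mulr_gt0// => h.
  by rewrite ler_pdivrMr ?mulr_gt0// -mulrA.
exists (cint 0 (2 * pi) k2 / (2 * pi)%:C) => [|z' z'rho].
  have -> : 4 * M / rho = 2 * (M * r / rho ^+ 2).
    by rewrite rE; field; rewrite gt_eqF.
  apply: scale; have := @normc_cint_le _ 0 (2 * pi) k2 (M * r / rho ^+ 2) (pi2_ge0 R) ik2.
  rewrite subr0; apply => t _; rewrite /k2 !normcM !normcV normc_circ gtr0_norm//.
  have := dist _ t zrho; set D := normc (circ r t - z) => hD.
  have D0 : 0 < D by apply: lt_le_trans hD.
  rewrite -!mulrA -expr2 exprVn; apply: ler_pM; rewrite ?normc_ge0//.
  - by rewrite mulr_ge0 ?invr_ge0 ?exprn_ge0 ?(ltW D0) ?(ltW r0).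
  - by rewrite fM// normc_circ gtr0_norm.
  rewrite ler_wpM2l ?(ltW r0)// lef_pV2 ?posrE ?exprn_gt0//.
  by rewrite lerXn2r ?nnegrE ?(ltW rho0) ?(ltW D0).
set u := z' - z.
(* Exact remainder from 1/(w - z') - 1/(w - z) - u/(w - z)^2 = u^2 / ((w - z') (w - z)^2). *)
pose k3 t := f (circ r t) * (circ r t * u ^+ 2 / ((circ r t - z') * (circ r t - z) ^+ 2)).
have E t : f (circ r t) * (circ r t / (circ r t - z')) -
    f (circ r t) * (circ r t / (circ r t - z)) - u * k2 t = k3 t.
  have h1 : circ r t - z' != 0 by rewrite subr_eq0 circ_neq ?far.
  have h2 : circ r t - z != 0 by rewrite subr_eq0 circ_neq ?far.
  by rewrite /k2 /k3 /u; field; rewrite h1 h2.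
have ib := complex_integrableB (measurable_itv _) (ik _ z'rho) (ik _ zrho).
have iu := complex_integrableZ (measurable_itv _) u ik2.
have ik3 : cintegrable 0 (2 * pi) k3.
  by rewrite -(funext E); exact: complex_integrableB.
have -> : f z' - f z - cint 0 (2 * pi) k2 / (2 * pi)%:C * u =
    cint 0 (2 * pi) k3 / (2 * pi)%:C.
  rewrite -(funext E) /cint complex_integralB// complex_integralB ?ik//.
  rewrite complex_integralZ//.
  - have := cauchy_formula (far _ z'rho); have := cauchy_formula (far _ zrho).
    rewrite /cmean /cint => -> ->.
    rewrite !mulrBl; congr (_ - _ - _); first by rewrite mulrAC divff ?mul1r.
      by rewrite mulrAC divff ?mul1r.
    by rewrite /u; ring.
  - exact: ik.
  - exact: ik.
have -> : 4 * M / rho ^+ 2 * normc u ^+ 2 = 2 * (M * (r * normc u ^+ 2 / rho ^+ 3)).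
  by rewrite rE; field; rewrite gt_eqF.
apply: scale; have := @normc_cint_le _ 0 (2 * pi) k3
  (M * (r * normc u ^+ 2 / rho ^+ 3)) (pi2_ge0 R) ik3.
rewrite subr0; apply => t _; rewrite /k3 !(normcM, normcV, normcX) normc_circ gtr0_norm//.
have := dist _ t zrho; have := dist _ t z'rho.
set D := normc (circ r t - z); set D' := normc (circ r t - z') => hD' hD.
have D0 : 0 < D by apply: lt_le_trans hD.
have D'0 : 0 < D' by apply: lt_le_trans hD'.
apply: ler_pM; rewrite ?normc_ge0 ?divr_ge0 ?mulr_ge0 ?exprn_ge0 ?normc_ge0//
  ?(ltW r0) ?(ltW D0) ?(ltW D'0)//.
  by rewrite fM// normc_circ gtr0_norm.
rewrite ler_wpM2l ?mulr_ge0 ?exprn_ge0 ?normc_ge0 ?(ltW r0)//.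
rewrite lef_pV2 ?posrE ?mulr_gt0 ?exprn_gt0//.
by rewrite exprS ler_pM ?exprn_ge0 ?(ltW rho0)// lerXn2r ?nnegrE ?(ltW rho0) ?(ltW D0).
Qed.

End cauchy.

(** * Monomials in the weighted space *)

Section weighted.
Variables (R : realType) (v : R -> {posnum R}).
Local Notation C := R[i].
Implicit Types (f g : Hinf v) (z : C).

Lemma weight_gt0 r : 0 < (v r)%:num.
Proof. by []. Qed.

Lemma Hinf_intro (h : C -> C^o) (B : R) : entire h ->
  (forall z, wabs v h z <= B) -> h \in Hinf_pred v.
Proof.
move=> eh hB; rewrite inE; split => //; apply: (@le_lt_trans _ _ B%:E).
  by apply: ge_ereal_sup => _ [z _ <-]; rewrite lee_fin.
by rewrite ltry.
Qed.

Lemma Hinf_entire f : entire f.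
Proof. by case: f => f /=; rewrite inE => -[]. Qed.

Definition hnorm f : R := fine (wnorm v f).

Lemma hnormE f : `|f| = (hnorm f)%:C.
Proof. by []. Qed.

Lemma hnorm_ge0 f : 0 <= hnorm f.
Proof. by rewrite fine_ge0// wnorm_ge0. Qed.

Lemma wabs_le_hnorm f z : wabs v f z <= hnorm f.
Proof. by rewrite -lee_fin wnorm_fineK wnorm_ub. Qed.

Lemma hnorm_le f (B : R) : (forall z, wabs v f z <= B) -> hnorm f <= B.
Proof.
move=> fB; rewrite -lee_fin wnorm_fineK.
by apply: ge_ereal_sup => _ [z _ <-]; rewrite lee_fin.
Qed.

Lemma wabsE (h : C -> C^o) z : wabs v h z = normc (h z) * (v (normc z))%:num.
Proof. by []. Qed.

Lemma normc_le_wabs (h : C -> C^o) z (B : R) : wabs v h z <= B ->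
  normc (h z) <= B / (v (normc z))%:num.
Proof. by rewrite ler_pdivlMr. Qed.

Hypothesis v_decr : forall r s : R, 0 <= r -> r <= s -> (v s)%:num <= (v r)%:num.
Hypothesis v_rapid : forall m : nat, r ^+ m * (v r)%:num @[r --> +oo] --> (0 : R).

Lemma rapid_small n (e : R) : 0 < e -> exists2 A : R, 0 < A &
  forall r, A <= r -> r ^+ n * (v r)%:num < e.
Proof.
move=> e0; have /cvgrPdist_lt/(_ _ e0)[A [_ hA]] := v_rapid n.
exists (Num.max A 0 + 1); first by rewrite ltr_pwDr// le_max lexx orbT.
move=> r Ar; have rA : A < r.
  by apply: lt_le_trans Ar; rewrite ltr_pwDr// le_max lexx.
by apply: le_lt_trans (hA _ rA); rewrite sub0r normrN ler_norm.
Qed.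

Lemma wabs_pow n z : wabs v (fun z => z ^+ n) z = normc z ^+ n * (v (normc z))%:num.
Proof. by rewrite wabsE normcX. Qed.

Lemma pow_bounded n : exists B : R, forall z, wabs v (fun z => z ^+ n) z <= B.
Proof.
have [A A0 hA] := rapid_small n ltr01.
exists (1 + A ^+ n * (v 0)%:num) => z; rewrite wabs_pow.
have [Az|/ltW zA] := leP A (normc z).
  apply: le_trans (ltW (hA _ Az)) _.
  by rewrite lerDl mulr_ge0// exprn_ge0// ltW.
apply: (@le_trans _ _ (A ^+ n * (v 0)%:num)); last by rewrite lerDr.
apply: ler_pM; rewrite ?exprn_ge0 ?normc_ge0//.
  by rewrite lerXn2r ?nnegrE ?normc_ge0 ?(ltW A0).
by rewrite v_decr ?normc_ge0.
Qed.

Lemma pow_entire n : entire (fun z : C => z ^+ n : C^o).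
Proof. by move=> z; exact: (@exprn_derivable C). Qed.

Lemma pow_in_Hinf n : (fun z : C => z ^+ n : C^o) \in Hinf_pred v.
Proof. by have [B] := pow_bounded n; apply: Hinf_intro; exact: pow_entire. Qed.

Definition mono n : Hinf v := MkHinf (pow_in_Hinf n).

Lemma mono_norm_gt0 n : 0 < hnorm (mono n).
Proof.
apply: lt_le_trans (wabs_le_hnorm (mono n) 1).
by rewrite wabs_pow normc1 expr1n mul1r.
Qed.

(** Half the norm is exceeded somewhere by definition of the supremum, without showing that a
    maximum is attained. *)
Lemma mono_attained n : exists2 r : R, 0 <= r &
  hnorm (mono n) / 2 <= r ^+ n * (v r)%:num.
Proof.
apply: contrapT => nh.
have : hnorm (mono n) <= hnorm (mono n) / 2.
  apply: hnorm_le => z; rewrite leNgt; apply/negP => zn; apply: nh.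
  by exists (normc z); rewrite ?normc_ge0// ltW// -wabs_pow.
by have := mono_norm_gt0 n; lra.
Qed.

Lemma mono_vanish n (e : R) : 0 < e -> exists2 A : R, 0 < A &
  forall z, A <= normc z -> wabs v (mono n) z < e.
Proof.
move=> /(rapid_small n)[A A0 hA]; exists A => // z Az.
by rewrite wabs_pow hA.
Qed.

(** From radius A to 2A the monomial gains the factor 2^n, while the weight loses at most the fixed
    factor [q], so a large n wins. *)
Lemma mono_small_disc (A e : R) : 0 < A -> 0 < e -> exists n, forall z,
  normc z <= A -> wabs v (mono n) z <= e * hnorm (mono n).
Proof.
move=> A0 e0; set q := (v 0)%:num / (v (2 * A))%:num.
have q0 : 0 < q by rewrite divr_gt0.
have [n hn] : exists n, q * 2^-1 ^+ n <= e.
  have : (fun n => q * (2^-1) ^+ n) @ \oo --> q * 0.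
    apply: cvgMr; apply: cvg_expr.
    by rewrite ger0_norm// invf_lt1// ltr1n.
  rewrite mulr0 => /cvgrPdist_le/(_ _ e0)[n _ h]; exists n.
  by have := h n (leqnn n); rewrite /= sub0r normrN; apply: le_trans; exact: ler_norm.
exists n => z zA; rewrite wabs_pow.
have h2 : (2 * A) ^+ n * (v (2 * A))%:num <= hnorm (mono n).
  have := wabs_le_hnorm (mono n) (2 * A)%:C.
  by rewrite wabs_pow normc_real ger0_norm// mulr_ge0// ltW.
apply: (@le_trans _ _ (q * 2^-1 ^+ n * ((2 * A) ^+ n * (v (2 * A))%:num))).
  have -> : q * 2^-1 ^+ n * ((2 * A) ^+ n * (v (2 * A))%:num) = A ^+ n * (v 0)%:num.
    rewrite /q exprVn exprMn; field.
    by rewrite expf_neq0//= gt_eqF.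
  apply: ler_pM; rewrite ?exprn_ge0 ?normc_ge0//.
    by rewrite lerXn2r ?nnegrE ?normc_ge0 ?(ltW A0).
  by rewrite v_decr ?normc_ge0.
apply: ler_pM => //; first by rewrite mulr_ge0 ?exprn_ge0 ?ltW.
by rewrite mulr_ge0 ?exprn_ge0 ?mulr_ge0// ltW.
Qed.

End weighted.

(** * The Hausdorff operator *)

Section hausdorff_operator.
Variables (R : realType) (v : R -> {posnum R}).
Local Notation C := R[i].
Variable mu : {measure set (measurableTypeR R) -> \bar R}.
Hypothesis v_cont : {within `[0, +oo[, continuous (fun r => (v r)%:num)}.
Hypothesis v_decr : forall r s : R, 0 <= r -> r <= s -> (v s)%:num <= (v r)%:num.
Hypothesis v_rapid : forall m : nat, r ^+ m * (v r)%:num @[r --> +oo] --> (0 : R).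
Hypothesis v_ratio : forall t : R, 1 < t ->
    (v (t * r))%:num / (v r)%:num @[r --> +oo] --> (0 : R).
Hypothesis mu_bounded : hausdorff_bounded mu v.
Implicit Types (f g : Hinf v) (z : C).

Let pos : set (measurableTypeR R) := `]0, +oo[%classic.
Let gt1 : set (measurableTypeR R) := `]1, +oo[%classic.
Let mpos : measurable pos. Proof. exact: measurable_itv. Qed.
Let mgt1 : measurable gt1. Proof. exact: measurable_itv. Qed.
Local Notation u n := (mono v_decr v_rapid n).

Lemma hausdorff_integrable f z :
  complex_integrable mu pos (hausdorff_integrand f z).
Proof. by case: mu_bounded => + _ _; apply. Qed.

Lemma hausdorff_mono_integrand n z t :
  hausdorff_integrand (u n) z t = z ^+ n * (t^-1 ^+ n.+1)%:C.
Proof.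
rewrite /hausdorff_integrand /= exprMn -mulrA; congr (_ * _).
by rewrite rmorphXn/= fmorphV exprSr.
Qed.

Lemma inv_pow_integrable n : mu.-integrable pos (fun t => (t^-1 ^+ n.+1)%:E).
Proof.
have [+ _] := hausdorff_integrable (u n) 1.
apply: eq_integrable => // t _.
by rewrite hausdorff_mono_integrand expr1n mul1r.
Qed.

Lemma complex_integral_real D (k : R -> R) :
  complex_integral mu D (fun t => (k t)%:C) = (\int[mu]_(t in D) k t)%:C.
Proof.
rewrite /complex_integral; congr (_ +i* _) => /=.
by rewrite /Rintegral integral0.
Qed.

Definition moment n := \int[mu]_(t in pos) (t^-1 ^+ n.+1).

Lemma hausdorff_mono n z : hausdorff mu (u n) z = (moment n)%:C * z ^+ n.
Proof.
rewrite /hausdorff (@eq_complex_integral _ _ _ _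
  (fun t => z ^+ n * (t^-1 ^+ n.+1)%:C)); last first.
  by move=> t _; rewrite hausdorff_mono_integrand.
rewrite complex_integralZ//; first by rewrite complex_integral_real mulrC.
split; first exact: inv_pow_integrable.
by apply: eq_integrable (integrable0 mu pos).
Qed.

Lemma moment_bounded : exists B : R, forall n, moment n <= B.
Proof.
have [_ _ [M hM]] := mu_bounded; exists (complex.Re M) => n.
have := hM (u n).
have -> : hausdorff_inf mu (u n) = (moment n)%:C *: u n.
  apply: val_inj; apply/funext => z.
  by rewrite /= (hausdorff_infE _ mu_bounded) hausdorff_mono.
rewrite normrZ ler_pM2r; last by rewrite hnormE ltcR mono_norm_gt0.
move=> /(le_trans (real_ler_norm _)) => h.
have : (moment n)%:C <= M by apply: h; rewrite complex_real.
by rewrite lecE => /andP[].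
Qed.

(** On []0, s]] the integrand of the n-th moment is at least s^(-n-1). Bounded moments thus give a
    mass of at most B s^(n+1) for all n, which tends to 0. *)
Lemma mu_itv0_lt1 (s : R) : 0 < s < 1 -> mu `]0, s]%classic = 0%E.
Proof.
move=> /andP[s0 s1]; have [B hB] := moment_bounded.
have mS : measurable (`]0, s]%classic : set (measurableTypeR R)) by exact: measurable_itv.
have Spos : `]0, s]%classic `<=` pos by apply: subset_itvl; rewrite bnd_simp.
have s'1 : s < 1 by [].
have bound n : (mu `]0%R, s]%classic <= (B * s ^+ n.+1)%:E)%E.
  rewrite mulrC EFinM -lee_pdivrMl ?exprn_gt0//.
  apply: (@le_trans _ _ (moment n)%:E); last by rewrite lee_fin.
  rewrite /moment fineK; last exact: integrable_fin_num (inv_pow_integrable n).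
  apply: (@le_trans _ _ (\int[mu]_(t in `]0%R, s]%classic) (t^-1 ^+ n.+1)%:E)%E).
    rewrite -integral_cst//; apply: ge0_le_integral => //.
    - by move=> t _; rewrite lee_fin invr_ge0 exprn_ge0// ltW.
    - apply: measurable_funS (measurable_int _ (inv_pow_integrable n)) => //.
    - move=> t /=; rewrite in_itv/= => /andP[t0 ts].
      rewrite lee_fin -exprVn lerXn2r ?nnegrE ?invr_ge0 ?(ltW s0) ?(ltW t0)//.
      by rewrite lef_pV2.
  apply: ge0_subset_integral => //.
    exact: measurable_int (inv_pow_integrable n).
  move=> t /=; rewrite /pos/= in_itv/= andbT => t0.
  by rewrite lee_fin exprn_ge0// invr_ge0 ltW.
have lim0 : (fun n => B * s ^+ n.+1) @ \oo --> 0.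
  rewrite (_ : 0 = B * 0); last by rewrite mulr0.
  apply: cvgMr; rewrite (cvg_shiftS (fun n => s ^+ n)).
  by apply: cvg_expr; rewrite ger0_norm// ltW.
apply/eqP; rewrite eq_le measure_ge0 andbT; apply/lee_addgt0Pr => e e0.
rewrite add0e; have /cvgrPdist_le/(_ _ e0)[n _ /(_ n (leqnn n))/=] := lim0.
rewrite sub0r normrN => h; apply: le_trans (bound n) _.
by rewrite lee_fin (le_trans (ler_norm _) h).
Qed.

Lemma mu_lt1 : mu `]0, 1[%classic = 0%E.
Proof.
apply: measure_negligible; first exact: measurable_itv.
have -> : `]0, (1 : R)[%classic = \bigcup_n `]0, n.+1%:R / n.+2%:R]%classic.
  apply/seteqP; split => t /=.
    rewrite in_itv/= => /andP[t0 t1].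
    have [n hn] : exists n, (1 - t)^-1 < n%:R :> R.
      by exists (Num.trunc (1 - t)^-1).+1; rewrite truncnS_gt.
    exists n => //=; rewrite in_itv/= t0/= ler_pdivlMr// -[n.+2%:R]natr1.
    have h : 1 < n%:R * (1 - t) by rewrite -ltr_pdivrMr ?subr_gt0// div1r.
    rewrite -natr1; nra.
  move=> [n _] /=; rewrite !in_itv/= => /andP[-> /le_lt_trans]; apply.
  by rewrite ltr_pdivrMr// mul1r ltr_nat.
apply: negligible_bigcup => n; apply/negligibleP; first exact: measurable_itv.
apply: mu_itv0_lt1; rewrite divr_gt0//= ltr_pdivrMr// mul1r ltr_nat//.
Qed.

Definition mass1 : R := fine (mu [set 1]).

Lemma mass1_ge0 : 0 <= mass1.
Proof. by rewrite fine_ge0. Qed.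

(** The integrand 1/t of [moment 0] equals 1 at t = 1, so the atom is at most that finite
    integral. *)
Lemma mu1_fin : mu [set 1] \is a fin_num.
Proof.
have h := integrable_fin_num mpos (inv_pow_integrable 0).
rewrite ge0_fin_numE//.
have -> : mu [set 1] = (\int[mu]_(t in [set 1%R]) (t^-1 ^+ 1)%:E)%E.
  rewrite -[LHS]mul1e -integral_cst//; apply: eq_integral => t.
  by rewrite inE/= => ->; rewrite invr1 expr1.
move: h; rewrite ge0_fin_numE; last first.
  apply: integral_ge0 => t; rewrite /pos/= in_itv/= andbT => t0.
  by rewrite lee_fin exprn_ge0// invr_ge0 ltW.
apply: le_lt_trans; apply: ge0_subset_integral => //.
- exact: measurable_int (inv_pow_integrable 0).
- move=> t /=; rewrite /pos/= in_itv/= andbT => t0.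
  by rewrite lee_fin exprn_ge0// invr_ge0 ltW.
- by move=> t /= ->; rewrite /pos/= in_itv/= ltr01.
Qed.

Lemma gt1_pos : gt1 `<=` pos.
Proof. by apply: subset_itvr; rewrite bnd_simp. Qed.

Lemma integral_split (k : R -> R) : mu.-integrable pos (EFin \o k) ->
  \int[mu]_(t in pos) k t = mass1 * k 1 + \int[mu]_(t in gt1) k t.
Proof.
move=> ki.
have m01 : measurable (`]0, 1[%classic : set (measurableTypeR R)).
  exact: measurable_itv.
have E : pos = (`]0, 1[%classic `|` ([set 1] `|` gt1) : set (measurableTypeR R)).
  apply/seteqP; split => t; rewrite /pos /gt1/= !in_itv/= !andbT.
    by move=> t0; case: (ltgtP t 1) => h; [left; rewrite t0|right; right|right; left].
  by case=> [/andP[]//|[->//|/(lt_trans ltr01)]].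
have sub1 : [set 1] `|` gt1 `<=` pos by rewrite E; exact: subsetUr.
have m1 : measurable ([set 1] `|` gt1 : set (measurableTypeR R)) by exact: measurableU.
rewrite {1}E Rintegral_setU//; first last.
- apply/disj_setPS => t [] /=; rewrite in_itv/= => /andP[_ t1] [t1'|].
    by rewrite t1' ltxx in t1.
  by rewrite /gt1/= in_itv/= andbT => /(lt_trans t1); rewrite ltxx.
- by rewrite -E.
rewrite Rintegral_setU//; first last.
- apply/disj_setPS => t [] /= ->; rewrite /gt1/= in_itv/= ltxx//.
- exact: integrableS ki.
rewrite [X in X + _](_ : _ = 0) ?add0r.
  congr (_ + _); rewrite (@eq_Rintegral _ _ _ _ _ (fun=> k 1)).
    by rewrite Rintegral_cst// mulrC.
  by move=> t; rewrite inE/= => ->.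
rewrite /Rintegral null_set_integral//; last exact: mu_lt1.
apply: measurable_funS (measurable_int _ ki) => //.
by rewrite E; exact: subsetUl.
Qed.

(** The operator T of the overview, taken pointwise. *)
Definition tail f z : C := complex_integral mu gt1 (hausdorff_integrand f z).

Lemma hausdorff_split f z : hausdorff mu f z = mass1%:C * f z + tail f z.
Proof.
have [hr hi] := hausdorff_integrable f z.
apply/eqP; rewrite eq_complex cReD cImD !cReM cImM /= !mul0r subr0 addr0.
by rewrite !integral_split// /hausdorff_integrand !divr1 !eqxx.
Qed.

Lemma tail_integrable f z : complex_integrable mu gt1 (hausdorff_integrand f z).
Proof.
have [hr hi] := hausdorff_integrable f z.
by split; [apply: integrableS hr|apply: integrableS hi] => //; exact: gt1_pos.
Qed.

Lemma tailB f g z : tail (f - g) z = tail f z - tail g z.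
Proof.
rewrite /tail -complex_integralB//; last 2 first.
- exact: tail_integrable.
- exact: tail_integrable.
by apply: eq_complex_integral => t _; rewrite /hausdorff_integrand /= mulrBl.
Qed.

Lemma inv_integrable : mu.-integrable gt1 (fun t => (t^-1)%:E).
Proof.
apply: eq_integrable (integrableS mpos mgt1 gt1_pos (inv_pow_integrable 0)) => // t _.
Qed.

Definition inv_mass := \int[mu]_(t in gt1) t^-1.

(** For t > 1 the point z / t stays in the disc, so only values of [f] there are read. *)
Lemma tail_le_disc f z (A e : R) : normc z <= A ->
  (forall w, normc w <= A -> normc (f w) <= e) ->
  normc (tail f z) <= 2 * (e * inv_mass).
Proof.
move=> zA fe; rewrite /inv_mass -RintegralZl//; last exact: inv_integrable.
apply: normc_complex_integral_le => //; first exact: tail_integrable.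
  apply: eq_integrable (integrableZl mgt1 e inv_integrable) => //.
move=> t; rewrite /gt1/= in_itv/= andbT => t1.
have t0 : 0 < t := lt_trans ltr01 t1.
rewrite /hausdorff_integrand normc_div normc_real gtr0_norm// ler_wpM2r//.
  by rewrite invr_ge0 ltW.
apply: fe; rewrite normc_div normc_real gtr0_norm//.
apply: le_trans zA; rewrite ler_pdivrMr// ler_peMr ?normc_ge0// ltW//.
Qed.

Let ratio (r t : R) : R := (v r)%:num / (v (r / t))%:num / t.

Definition eps r := \int[mu]_(t in gt1) ratio r t.

Lemma ratio_ge0 r t : 1 < t -> 0 <= ratio r t.
Proof. by move=> t1; rewrite !divr_ge0// ltW// (lt_trans ltr01). Qed.

Lemma ratio_le r t : 0 <= r -> 1 < t -> ratio r t <= t^-1.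
Proof.
move=> r0 t1; have t0 : 0 < t := lt_trans ltr01 t1.
rewrite /ratio -[leRHS]mul1r ler_wpM2r ?invr_ge0 ?(ltW t0)//.
rewrite ler_pdivrMr// mul1r v_decr ?divr_ge0 ?(ltW t0)//.
by rewrite ler_pdivrMr// ler_peMr// ltW.
Qed.

Lemma ratio_measurable r : 0 < r -> measurable_fun gt1 (ratio r).
Proof.
move=> r0; apply: open_continuous_measurable_fun.
  exact: (@interval_open R (BRight 1) +oo%O).
move=> t; rewrite inE/= /gt1/= in_itv/= andbT => t1.
have t0 : 0 < t := lt_trans ltr01 t1.
have vrt : {for r / t, continuous (fun r => (v r)%:num)}.
  have := v_cont; move/continuous_within_itvcyP => [+ _]; apply.
  by rewrite in_itv/= andbT divr_gt0.
have tV : (t' ^-1) @[t' --> t] --> t^-1 by apply: cvgV; rewrite ?gt_eqF.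
rewrite /ratio; apply: cvgM => //; apply: cvgMr; apply: cvgV; first by rewrite gt_eqF.
apply: (@cvg_comp _ _ _ (fun t => r / t) (fun r => (v r)%:num)); last exact: vrt.
exact: cvgMr.
Qed.

Lemma ratio_integrable r : 0 < r -> mu.-integrable gt1 (EFin \o ratio r).
Proof.
move=> r0; apply: le_integrable inv_integrable => //.
  by apply/measurable_EFinP; exact: ratio_measurable.
move=> t; rewrite /gt1/= in_itv/= andbT => t1.
have t0 : 0 < t := lt_trans ltr01 t1.
by rewrite lee_fin !ger0_norm ?ratio_ge0 ?ratio_le ?invr_ge0 ?(ltW r0) ?(ltW t0).
Qed.

Lemma eps_ge0 r : 0 <= eps r.
Proof.
by apply: Rintegral_ge0 => t; rewrite /gt1/= in_itv/= andbT; exact: ratio_ge0.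
Qed.

(** Dominated convergence with the bound 1/t of [ratio_le]. It is a theorem on sequences, hence the
    passage to an arbitrary sequence of radii tending to infinity. *)
Lemma eps_cvg0 : eps r @[r --> +oo] --> (0 : R).
Proof.
apply/cvg_pinftyP => r roo.
have /cvgryPgt/(_ 0)[N _ rN] := roo.
(* Dropping N terms makes every radius positive, as [ratio_measurable] and the domination
   require. *)
rewrite -(cvg_shiftn N).
have int0 : (0%:E = \int[mu]_(t in gt1) (fun=> 0%E : \bar R) t)%E by rewrite integral0.
suff : (\int[mu]_(t in gt1) (ratio (r (n + N)%N) t)%:E)%E @[n --> \oo] --> 0%:E.
  by move=> /fine_cvg.
rewrite int0; apply: (@dominated_cvg _ _ _ mu gt1 mgt1
  (fun n t => (ratio (r (n + N)%N) t)%:E) _ (fun t => (t^-1)%:E)) => //.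
- move=> n; apply/measurable_EFinP.
  exact: ratio_measurable (rN (n + N)%N (leq_addl n N)).
- move=> t; rewrite /gt1/= in_itv/= andbT => t1.
  have t0 : 0 < t := lt_trans ltr01 t1.
  apply: cvg_EFin; first exact: nearW.
  have rt : (r n / t) @[n --> \oo] --> +oo.
    have ti0 : 0 < t^-1 by rewrite invr_gt0.
    exact: (cvg_comp _ _ roo (gt0_cvgMly ti0 cvg_id)).
  (* The ratio hypothesis is taken at the radii [r n / t], since t * (r n / t) = r n. *)
  have /cvg_pinftyP/(_ _ rt) := v_ratio t1.
  under eq_fun do rewrite [t * _]mulrC divfK ?gt_eqF//.
  rewrite -(cvg_shiftn N) => c.
  by have := cvgM c (cvg_cst t^-1); rewrite mul0r; exact.
- exact: inv_integrable.
- move=> k t; rewrite /gt1/= in_itv/= andbT => t1.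
  rewrite lee_fin ger0_norm ?ratio_ge0// ratio_le// ltW//.
  exact: (rN (k + N)%N (leq_addl k N)).
Qed.

(** Since |f(z/t)| <= B / v(|z|/t), multiplying the integrand by v(|z|) brings out [ratio]. The
    factor 2 is the cost of bounding a complex integral by its parts. *)
Lemma tail_le_eps f z (B : R) : z != 0 -> (forall w, wabs v f w <= B) ->
  normc (tail f z) * (v (normc z))%:num <= 2 * (B * eps (normc z)).
Proof.
move=> z0 fB; have nz0 : 0 < normc z by rewrite normc_gt0.
have B0 : 0 <= B := le_trans (wabs_ge0 v f 0) (fB 0).
rewrite -ler_pdivlMr//.
have -> : 2 * (B * eps (normc z)) / (v (normc z))%:num =
    2 * \int[mu]_(t in gt1) (B / (v (normc z))%:num * ratio (normc z) t).
  rewrite RintegralZl//; last exact: ratio_integrable.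
  by rewrite -mulrA; congr (_ * _); rewrite mulrAC.
apply: normc_complex_integral_le => //; first exact: tail_integrable.
  apply: eq_integrable (integrableZl mgt1 (B / (v (normc z))%:num)
    (ratio_integrable nz0)) => //.
move=> t; rewrite /gt1/= in_itv/= andbT => t1.
have t0 : 0 < t := lt_trans ltr01 t1.
have nzt : normc (z / t%:C) = normc z / t.
  by rewrite normc_div normc_real gtr0_norm.
rewrite /hausdorff_integrand normc_div normc_real gtr0_norm//.
rewrite /ratio !mulrA divfK ?gt_eqF// ler_wpM2r ?invr_ge0 ?(ltW t0)//.
by rewrite -nzt; exact: normc_le_wabs.
Qed.

End hausdorff_operator.

(** * Weak topology of [H0 v] *)

Section weak_topology.
Variables (R : realType) (v : R -> {posnum R}).
Local Notation C := R[i].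
Implicit Types (f g : H0 v) (z : C).

Definition eval0 z f : C^o := f z.

Lemma eval0_linear z : linear (eval0 z).
Proof. by []. Qed.

HB.instance Definition _ z :=
  GRing.isLinear.Build C (H0 v) C^o *:%R (eval0 z) (eval0_linear z).

Lemma H0_normE f : `|f| = (hnorm f)%:C.
Proof. by []. Qed.

Lemma eval0_continuous z : continuous (eval0 z).
Proof.
suff evc (f : H0 v) : eval0 z @ nbhs f --> eval0 z f by exact: evc.
apply/cvgrPdist_lt => e e0.
have eE := gt0_RRe e0.
have re0 : 0 < complex.Re e by move: e0; rewrite eE ltcR.
have K0 : 0 < complex.Re e * (v (normc z))%:num by rewrite mulr_gt0.
apply/(@nbhs_normP C (H0 v)); exists (complex.Re e * (v (normc z))%:num)%:C => /=.
  by rewrite ltcR.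
move=> g /=; rewrite H0_normE ltcR => fg.
rewrite eE -normc_lt_norm.
have := wabs_le_hnorm (f - g : H0 v) z; rewrite /wabs => h.
have := le_lt_trans h fg; rewrite ltr_pM2r//.
Qed.

Definition eval0_dual z : dual (H0 v) :=
  exist _ (eval0 z : {linear H0 v -> C^o}) (@eval0_continuous z).

Lemma weak_eval_continuous z : continuous (eval0 z : weak (H0 v) -> C^o).
Proof.
move=> f; apply: (@continuous_comp (weak (H0 v)) {ptws dual (H0 v) -> C^o} C^o
   (fun x phi => sval phi x) (fun F => F (eval0_dual z))).
  exact: initial_continuous.
exact: (@proj_continuous (dual (H0 v)) (fun=> C^o) (eval0_dual z)).
Qed.

Lemma norm_weak_continuous : continuous (id : H0 v -> weak (H0 v)).
Proof.
apply: continuous_comp_initial.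
suff cvgf (f : H0 v) : ((fun x phi => sval phi x) : H0 v -> {ptws dual (H0 v) -> C^o})
    @ nbhs f --> ((fun phi => sval phi f) : {ptws dual (H0 v) -> C^o}).
  by exact: cvgf.
apply/cvg_sup => phi; move: f.
apply/(@continuousP _ (initial_topology (@^~ phi))) => A [B oB <-].
apply: (@open_comp _ _ (sval phi : H0 v -> C^o)) => // f _.
exact: (svalP phi).
Qed.

(** [m] depends on [z]: only a cluster point is obtained, not a convergent subsequence, because the
    weak topology need not be first countable. *)
Lemma weak_cluster_point (A : set (weak (H0 v))) (y : nat -> H0 v) :
  precompact A -> (forall m, A (y m)) ->
  exists g : H0 v, forall z (e : R) k, 0 < e ->
    exists2 m, (k < m)%N & normc (y m z - g z) < e.
Proof.
move=> [K AK [cK _]] yA; pose w m : weak (H0 v) := y m.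
have wK : (w m @[m --> \oo]) K by exists 0%N => // m _; exact: AK.
have [g [_ clg]] := cK _ _ wK; exists g => z e k e0.
have eC0 : 0 < e%:C by rewrite ltcR.
have /cvgrPdist_lt/(_ _ eC0) gnb := @weak_eval_continuous z g.
have tailw : (w m @[m --> \oo]) (w @` [set m | (k < m)%N]).
  by exists k.+1 => // m /= km; exists m.
have [_ [[m /= km <-] ym]] := clg _ _ tailw gnb.
by exists m => //; move: ym; rewrite /= -normc_lt_norm normcB.
Qed.

(** Point evaluations are weakly continuous and separate functions. This makes weakly compact sets
    weakly closed in [weakly_compact_hausdorff0]. *)
Lemma weak_hausdorff : hausdorff_space (weak (H0 v)).
Proof.
move=> f g fg; apply/val_inj/val_inj/funext => z.
apply: (@norm_hausdorff C C^o (eval0 z f) (eval0 z g)) => A B Af Bg.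
have [h [Ah Bh]] := fg _ _
  (@weak_eval_continuous z f A Af) (@weak_eval_continuous z g B Bg).
by exists (eval0 z h).
Qed.

Lemma H0_closed (h : Hinf v) :
  (forall e : R, 0 < e -> exists f : H0 v, hnorm (h - f) <= e) -> h \in @H0_pred R v.
Proof.
move=> hf; rewrite inE => e e0.
have e2 : 0 < e / 2 by rewrite divr_gt0.
have [f fh] := hf _ e2.
have : H0_val f \in @H0_pred R v := valP f.
rewrite inE => /(_ _ e2) [A [Ar hA]]; exists A; split => // r Arr z rz.
have := hA r Arr z rz; have := wabs_le_hnorm (h - f) z.
rewrite /wabs => h1 h2.
have : normc (h z) <= normc ((h - f : Hinf v) z) + normc (f z).
  by rewrite -[h z](subrK (f z)); exact: le_normcD.
move=> /(ler_wpM2r (ltW (weight_gt0 v (normc z)))); rewrite mulrDl.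
lra.
Qed.

(** A cluster point in [Hinf v] of the pushed filter is approached in norm by elements of [H0 v],
    hence belongs to it by [H0_closed], and the two norms agree. *)
Lemma preimage_H0_compact (K : set (Hinf v)) : compact K ->
  compact ((@H0_val R v) @^-1` K).
Proof.
move=> cK F FF FK.
have FG : ProperFilter (H0_val x @[x --> F]) by exact: fmap_proper_filter.
have [x [Kx xF]] := cK _ FG FK.
have ballx (e : R) : 0 < e -> nbhs x (ball x e%:C).
  by move=> e0; apply: nbhsx_ballx; rewrite ltcR.
have Hx : x \in @H0_pred R v.
  apply: H0_closed => e e0.
  have [_ [[f _ <-] xf]] : range (@H0_val R v) `&` ball x e%:C !=set0.
    apply: xF; last exact: ballx.
    apply: (@filterS _ F _ setT (@H0_val R v @^-1` range (@H0_val R v))).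
      by move=> f _; exists f.
    exact: filterT.
  by exists f; move: xf; rewrite -ball_normE/= hnormE ltcR => /ltW.
exists (MkH0 Hx); split => // A B FA /nbhs_ballP[e /= e0 eB].
have eE := gt0_RRe e0.
have [_ [[f Af <-] xf]] : (@H0_val R v) @` A `&` ball x e !=set0.
  apply: xF; last by rewrite eE; apply: ballx; move: e0; rewrite {1}eE ltcR.
  apply: (@filterS _ F _ A (@H0_val R v @^-1` (@H0_val R v @` A))) => //.
  by move=> f Af; exists f.
by exists f; split => //; apply: eB; move: xf; rewrite -!ball_normE.
Qed.

Lemma weakly_compact_hausdorff0 (mu : {measure set (measurableTypeR R) -> \bar R}) :
  hausdorff_bounded mu v ->
  compact_operator (@hausdorff_inf R mu v) ->
  weakly_compact_operator (@hausdorff_0 R mu v).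
Proof.
move=> [_ _ [M HM]] [K HK [cK _]].
have cK0 : compact ((id : H0 v -> weak (H0 v)) @` ((@H0_val R v) @^-1` K)).
  apply: continuous_compact; last exact: preimage_H0_compact.
  by apply: continuous_subspaceT; exact: norm_weak_continuous.
exists ((id : H0 v -> weak (H0 v)) @` ((@H0_val R v) @^-1` K)); last first.
  by split => //; apply: compact_closed => //; exact: weak_hausdorff.
move=> _ [f f1 <-]; exists (hausdorff_0 mu f) => //=.
(* Both branches of [insubd] land in [K]: the default value 0 is itself the image of 0, which lies
   in the unit ball. *)
rewrite -[H0_val _]/(val _) val_insubd; case: ifP => _.
  by apply: HK; exists (H0_val f).
apply: HK; exists 0; first by rewrite /= normr0.
by apply/normr0_eq0/le_anti; rewrite normr_ge0 andbT (le_trans (HM 0))// normr0 mulr0.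
Qed.

End weak_topology.

(** * Gliding hump *)

Section not_weakly_compact.
Variables (R : realType) (v : R -> {posnum R}).
Local Notation C := R[i].
Variable mu : {measure set (measurableTypeR R) -> \bar R}.
Hypothesis v_cont : {within `[0, +oo[, continuous (fun r => (v r)%:num)}.
Hypothesis v_decr : forall r s : R, 0 <= r -> r <= s -> (v s)%:num <= (v r)%:num.
Hypothesis v_rapid : forall m : nat, r ^+ m * (v r)%:num @[r --> +oo] --> (0 : R).
Hypothesis v_ratio : forall t : R, 1 < t ->
    (v (t * r))%:num / (v r)%:num @[r --> +oo] --> (0 : R).
Hypothesis mu_bounded : hausdorff_bounded mu v.
Implicit Types (f g : H0 v) (z : C).
Local Notation u n := (mono v_decr v_rapid n).

Lemma H0_intro (h : Hinf v) : (forall e : R, 0 < e -> exists A : R,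
  forall z, A <= normc z -> wabs v h z < e) -> h \in @H0_pred R v.
Proof.
move=> hv; rewrite inE => e /hv[A hA]; exists A; split; first exact: num_real.
move=> r Ar z rz; by apply: hA; rewrite (le_trans (ltW Ar)).
Qed.

Lemma H0_vanish f (e : R) : 0 < e -> exists2 A : R, 0 < A &
  forall z, A <= normc z -> wabs v f z < e.
Proof.
have : H0_val f \in @H0_pred R v := valP f.
rewrite inE => h /h[A [_ hA]]; exists (Num.max A 0 + 1).
  by rewrite ltr_pwDr// le_max lexx orbT.
move=> z Az; apply: (hA (normc z)) => //; apply: lt_le_trans Az.
by rewrite ltr_pwDr// le_max lexx.
Qed.

Lemma mono_in_H0 n : u n \in @H0_pred R v.
Proof.
by apply: H0_intro => e /(mono_vanish v_decr v_rapid n)[A _ hA]; exists A.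
Qed.

Definition hump n : H0 v := (hnorm (u n))^-1%:C *: MkH0 (mono_in_H0 n).

Lemma H0_addE f g z : (f + g) z = f z + g z.
Proof. by []. Qed.

Lemma humpE n z : hump n z = (hnorm (u n))^-1%:C * z ^+ n.
Proof. by []. Qed.

Lemma wabs_hump n z : wabs v (hump n) z = wabs v (u n) z / hnorm (u n).
Proof.
rewrite /wabs humpE normcM normc_real ger0_norm ?invr_ge0 ?hnorm_ge0//.
by rewrite -mulrA mulrC.
Qed.

Lemma wabsD (h k : Hinf v) z : wabs v (h + k : Hinf v) z <= wabs v h z + wabs v k z.
Proof. by rewrite /wabs -mulrDl ler_wpM2r// le_normcD. Qed.

Lemma eps_vanish (e : R) : 0 < e -> exists2 A : R, 0 < A &
  forall r, A <= r -> eps v mu r < e.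
Proof.
move=> e0; have := eps_cvg0 v_cont v_decr v_rapid v_ratio mu_bounded.
move=> /cvgrPdist_lt/(_ _ e0)[A [_ hA]]; exists (Num.max A 0 + 1).
  by rewrite ltr_pwDr// le_max lexx orbT.
move=> r Ar; have rA : A < r.
  by apply: lt_le_trans Ar; rewrite ltr_pwDr// le_max lexx.
by apply: le_lt_trans (hA _ rA); rewrite sub0r normrN ler_norm.
Qed.

(** The term mu({1}) f vanishes at infinity because [f] does; the tail does so through [eps], as it
    would for any element of [Hinf v]. *)
Lemma hausdorff_H0 f : hausdorff_inf mu f \in @H0_pred R v.
Proof.
apply: H0_intro => e e0; have a0 := mass1_ge0 mu.
have a1 : 0 < mass1 mu + 1 by rewrite ltr_wpDl.
have B0 := hnorm_ge0 (H0_val f).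
have B1 : 0 < hnorm (H0_val f) + 1 by rewrite ltr_wpDl.
have e1 : 0 < e / 2 / (mass1 mu + 1) by rewrite !divr_gt0.
have e2 : 0 < e / 4 / (hnorm (H0_val f) + 1) by rewrite !divr_gt0.
have [A1 A10 h1] := H0_vanish f e1; have [A2 A20 h2] := eps_vanish e2.
exists (Num.max A1 A2) => z; rewrite ge_max => /andP[zA1 zA2].
have z0 : z != 0 by rewrite -normc_gt0 (lt_le_trans A10).
have := h1 _ zA1; have := h2 _ zA2; rewrite !ltr_pdivlMr// => ez fz.
have := tail_le_eps v_cont v_decr v_rapid mu_bounded z0 (wabs_le_hnorm f).
rewrite /wabs (hausdorff_infE _ mu_bounded).
rewrite (hausdorff_split v_decr v_rapid mu_bounded) => tz.
apply: (@le_lt_trans _ _ (mass1 mu * wabs v f z +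
    normc (tail mu f z) * (v (normc z))%:num)).
  rewrite /wabs mulrA -mulrDl ler_wpM2r//; apply: le_trans (le_normcD _ _) _.
  by rewrite normcM normc_real ger0_norm.
have := eps_ge0 v mu (normc z); have := wabs_ge0 v f z; nra.
Qed.

Lemma hausdorff_0E f z :
  hausdorff_0 mu f z = (mass1 mu)%:C * f z + tail mu f z.
Proof.
rewrite -(hausdorff_split v_decr v_rapid mu_bounded) -(hausdorff_infE _ mu_bounded).
by rewrite -[H0_val (hausdorff_0 mu f)]/(val _) val_insubd hausdorff_H0.
Qed.

(* Adding a hump of high degree, which is small where [f] is not, increases the
   bound on [f] by little. *)
Lemma hump_step f (B de A0 : R) : 1 <= B -> 0 < de ->
  (forall z, wabs v f z <= B) -> exists n r, [/\ 0 <= r, A0 <= r,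
    1 / 2 <= wabs v (hump n) r%:C & forall z, wabs v (f + hump n) z <= B + de].
Proof.
move=> B1 de0 fB; have [A1 A10 h1] := H0_vanish f de0.
pose A := Num.max A1 A0; have A'0 : 0 < A by rewrite lt_max A10.
(* Below 1 / 4 on the disc of radius A while at least 1 / 2 at r, the hump must have r outside the
   disc, whence r >= A0. *)
have d0 : 0 < Num.min de (1 / 4) by rewrite lt_min de0; lra.
have dde : Num.min de (1 / 4) <= de by rewrite ge_min lexx.
have d4 : Num.min de (1 / 4) <= 1 / 4 by rewrite ge_min lexx orbT.
have [n hn] := mono_small_disc v_decr v_rapid A'0 d0.
have N0 := mono_norm_gt0 v_decr v_rapid n.
have [r r0 hr] := mono_attained v_decr v_rapid n.
have hr2 : 1 / 2 <= wabs v (hump n) r%:C.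
  by rewrite wabs_hump wabs_pow normc_real ger0_norm// ler_pdivlMr//; lra.
have small z : normc z <= A -> wabs v (hump n) z <= Num.min de (1 / 4).
  by move=> /hn; rewrite wabs_hump ler_pdivrMr.
exists n, r; split => //.
  have [rA|/ltW] := leP r A; last by apply: le_trans; rewrite le_max lexx orbT.
  by have := small r%:C; rewrite normc_real ger0_norm// => /(_ rA); lra.
move=> z; apply: le_trans (wabsD _ _ _) _.
have [zA|/ltW Az] := leP (normc z) A.
  by rewrite lerD// (le_trans (small _ zA)).
(* Outside the disc the roles swap: [f] is below de, and the normalised hump is at most 1 <= B. *)
rewrite addrC; apply: lerD; last first.
  by rewrite ltW// h1// (le_trans _ Az)// le_max lexx.
apply: le_trans B1; rewrite wabs_hump ler_pdivrMr// mul1r.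
exact: wabs_le_hnorm.
Qed.

Lemma hump_sequence : exists (F : nat -> H0 v) (n_ : nat -> nat) (r_ : nat -> R),
  [/\ forall k, F k.+1 = F k + hump (n_ k), F 0%N = 0,
    forall k z, wabs v (F k) z <= 2 &
    forall k, [/\ 0 <= r_ k, k%:R <= r_ k & 1 / 2 <= wabs v (hump (n_ k)) (r_ k)%:C]].
Proof.
(* Starts at 1, as [hump_step] demands, and the increments 2^-(k+1) keep it below 2. *)
pose B k : R := 2 - 2^-1 ^+ k.
have B2 k : B k <= 2 by rewrite gerBl exprn_ge0.
have B1 k : 1 <= B k.
  have : (2^-1 : R) ^+ k <= 1 by rewrite exprn_ile1// invf_le1// ler1n.
  by rewrite /B; lra.
have BS k : B k.+1 = B k + 2^-1 ^+ k.+1 by rewrite /B exprS; lra.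
(* The state carries its index because the bound depends on it; degrees and radii are recovered from
   [next] by [choice]. *)
pose ok (x : nat * H0 v) := forall z, wabs v x.2 z <= B x.1.
pose next (x y : nat * H0 v) (nr : nat * R) := [/\ ok y, y.1 = x.1.+1,
  y.2 = x.2 + hump nr.1 &
  [/\ 0 <= nr.2, x.1%:R <= nr.2 & 1 / 2 <= wabs v (hump nr.1) nr.2%:C]].
have step (x : nat * H0 v) : {y | ok x -> exists nr, next x y nr}.
  apply/cid; have [okx|nok] := pselect (ok x); last by exists x.
  have d0 : 0 < (2^-1 : R) ^+ x.1.+1 by rewrite exprn_gt0.
  have [n [r [r0 xr hr hB]]] := @hump_step x.2 (B x.1) _ x.1%:R (B1 _) d0 okx.
  exists (x.1.+1, x.2 + hump n) => _; exists (n, r); split => //.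
  by move=> z; rewrite /= BS; exact: hB.
have [s [s0 sS]] := dependent_choice step (0%N, 0).
have oks k : ok (s k).
  elim: k => [z|k IH]; last by have [nr []] := sS k IH.
  rewrite s0 /= /wabs normc0 mul0r; exact: le_trans (B1 0%N).
have [nr hnr] := choice (fun k => sS k (oks k)).
have sk k : (s k).1 = k.
  by elim: k => [|k IH]; [rewrite s0|have [_ -> _ _] := hnr k; rewrite IH].
exists (fun k => (s k).2), (fun k => (nr k).1), (fun k => (nr k).2); split.
- by move=> k; have [] := hnr k.
- by rewrite s0.
- by move=> k z; apply: le_trans (oks k z) _.
- by move=> k; have [_ _ _ []] := hnr k; rewrite sk.
Qed.

(** No cancellation on the positive half-line: a later hump cannot lower the sum at an earlier point
    r_k. *)
Lemma hump_ge0 n (r : R) : 0 <= r -> 0 <= complex.Re (hump n r%:C).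
Proof.
move=> r0; rewrite humpE -rmorphXn -rmorphM /=.
by rewrite mulr_ge0 ?invr_ge0 ?hnorm_ge0 ?exprn_ge0.
Qed.

Lemma wabs_hump_real n (r : R) : 0 <= r ->
  wabs v (hump n) r%:C = complex.Re (hump n r%:C) * (v r)%:num.
Proof.
move=> r0; rewrite /wabs normc_real (ger0_norm r0); congr (_ * _).
have := hump_ge0 n r0; rewrite humpE -rmorphXn -rmorphM normc_real /= => h.
exact: ger0_norm.
Qed.

Lemma weakly_compact_mass1_eq0 :
  weakly_compact_operator (@hausdorff_0 R mu v) -> mu [set (1 : R)] = 0%E.
Proof.
(* The main term weighs at least a / 4, whereas the three errors together stay below 3a / 16. *)
have arith (a p q t X : R) : 0 < a -> a * (2^-1 * (1 / 2)) <= X ->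
  X <= p + q + t -> p < a / 16 -> q < a / 16 -> t < a / 16 -> False by lra.
move=> wc.
have a0 := mass1_ge0 mu.
suff a00 : mass1 mu = 0.
  by rewrite -(fineK (mu1_fin v_decr v_rapid mu_bounded)) -/(mass1 mu) a00.
apply/eqP; rewrite eq_le a0 andbT leNgt; apply/negP => {}a0.
have [F [n_ [r_ [FS F0 F2 hr]]]] := hump_sequence.
have Fge0 (r : R) m : 0 <= r -> 0 <= complex.Re (F m r%:C).
  move=> r0; elim: m => [|m IH]; first by rewrite F0.
  by rewrite FS H0_addE cReD addr_ge0// hump_ge0.
have Fbig k m : (k < m)%N -> 1 / 2 <= complex.Re (F m (r_ k)%:C) * (v (r_ k))%:num.
  have [r0 _ h] := hr k; elim: m => [//|m IH].
  rewrite ltnS leq_eqVlt FS H0_addE cReD mulrDl.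
  move=> /predU1P[<-|/IH {}IH].
    by rewrite -wabs_hump_real// ler_wpDl// mulr_ge0// Fge0.
  by apply: le_trans IH _; rewrite lerDl mulr_ge0// hump_ge0.
(* Halving brings the sequence, bounded by 2, into the unit ball. *)
pose x m : H0 v := (2^-1 : R)%:C *: F m.
have xE m z : x m z = (2^-1 : R)%:C * F m z by [].
have x1 m z : wabs v (x m) z <= 1.
  rewrite /wabs xE normcM normc_real ger0_norm// -mulrA.
  by have := F2 m z; rewrite /wabs; lra.
pose y m : H0 v := hausdorff_0 mu (x m).
have [|g hg0] := weak_cluster_point (y := y) wc.
  move=> m; exists (x m) => //=.
  by rewrite H0_normE -[1]/((1 : R)%:C) lecR; apply: hnorm_le; exact: x1.
have a16 : 0 < mass1 mu / 16 by rewrite divr_gt0.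
have a32 : 0 < 2^-1 * (mass1 mu / 16) by rewrite mulr_gt0.
have [A1 A10 h1] := H0_vanish g a16; have [A2 A20 h2] := eps_vanish a32.
(* [k] depends only on [g] and [eps]. Then [m] > k is chosen with [y m] close to g at r_k, and
   [Fbig] holds for every such m. *)
have [k [kA1 kA2]] : exists k : nat, A1 <= k%:R /\ A2 <= k%:R.
  exists (Num.trunc (Num.max A1 A2)).+1.
  have := ltW (truncnS_gt (Num.max A1 A2)); rewrite ge_max => /andP[].
  by [].
have [r0 kr _] := hr k; set r := r_ k in r0 kr *.
have rp : 0 < r by apply: lt_le_trans kr; exact: lt_le_trans kA1.
have nr : normc r%:C = r by rewrite normc_real ger0_norm.
have e0 : 0 < mass1 mu / 16 / (v r)%:num by rewrite divr_gt0.
have [m km] := hg0 r%:C _ k e0; rewrite ltr_pdivlMr// => hgy.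
have hg : normc (g r%:C) * (v r)%:num < mass1 mu / 16.
  by have := h1 r%:C; rewrite /wabs nr; apply; exact: le_trans kr.
have ht : normc (tail mu (x m) r%:C) * (v r)%:num < mass1 mu / 16.
  have rC0 : r%:C != 0 :> C by rewrite -normc_gt0 nr.
  have := tail_le_eps v_cont v_decr v_rapid mu_bounded rC0 (x1 m).
  rewrite nr => /le_lt_trans; apply; rewrite mul1r -ltr_pdivlMl//.
  exact: h2 (le_trans kA2 kr).
have hx : mass1 mu * (2^-1 * (1 / 2)) <=
    normc ((mass1 mu)%:C * x m r%:C) * (v r)%:num.
  rewrite normcM normc_real (gtr0_norm a0) -mulrA ler_pM2l//.
  rewrite xE normcM normc_real ger0_norm// -mulrA ler_pM2l//.
  apply: le_trans (Fbig k m km) _; rewrite -/r ler_wpM2r//.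
  exact: le_trans (ler_norm _) (normc_Re _).
have : normc ((mass1 mu)%:C * x m r%:C) <=
    normc (y m r%:C - g r%:C) + normc (g r%:C) + normc (tail mu (x m) r%:C).
  have -> : (mass1 mu)%:C * x m r%:C = y m r%:C - tail mu (x m) r%:C.
    by rewrite hausdorff_0E addrK.
  apply: le_trans (le_normcD _ _) _; rewrite normcN lerD2r.
  by rewrite -[X in normc X](subrK (g r%:C)); exact: le_normcD.
move=> /(ler_wpM2r (ltW (weight_gt0 v r))); rewrite !mulrDl => hX.
exact: arith a0 hx hX hgy hg ht.
Qed.

End not_weakly_compact.

(** * Compactness *)

Section ultrafilter_limits.
Variables (R : realType) (T : Type) (V : set_system T).
Local Notation C := R[i].
Hypothesis UV : UltraFilter V.

(** Compactness gives a cluster point. An ultrafilter contains each set or its complement, so a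
    cluster point is a limit. *)
Lemma ultra_real_limit (phi : T -> R) (M : R) : V [set x | `|phi x| <= M] ->
  exists l, forall e : R, 0 < e -> V [set x | `|phi x - l| <= e].
Proof.
move=> phiM; have FV : ProperFilter (phi x @[x --> V]) by exact: fmap_proper_filter.
have VM : V (phi @^-1` `[- M, M]%classic).
  by apply: filterS phiM => x /= h; rewrite in_itv/= -ler_norml.
have [l [_ cl]] := @segment_compact R (- M) M _ FV VM.
exists l => e e0; have [//|Vn] := in_ultra_setVsetC [set x | `|phi x - l| <= e] UV.
have Vim : V (phi @^-1` (phi @` ~` [set x | `|phi x - l| <= e])).
  by apply: filterS Vn => x nx; exists x.
have := cl _ (ball l e) Vim; case; first exact: nbhsx_ballx.
by move=> _ [[x /= nx <-]]; rewrite /ball/= distrC => /ltW.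
Qed.

Lemma ultra_limit (phi : T -> C) (M : R) : V [set x | normc (phi x) <= M] ->
  exists l, forall e : R, 0 < e -> V [set x | normc (phi x - l) <= e].
Proof.
move=> phiM.
have [|a ha] := @ultra_real_limit (fun x => complex.Re (phi x)) M.
  by apply: filterS phiM => x /=; apply: le_trans; exact: normc_Re.
have [|b hb] := @ultra_real_limit (fun x => complex.Im (phi x)) M.
  by apply: filterS phiM => x /=; apply: le_trans; exact: normc_Im.
exists (a +i* b) => e e0; have e2 : 0 < e / 2 by rewrite divr_gt0.
apply: filterS2 (ha _ e2) (hb _ e2) => x /= xa xb.
apply: le_trans (normc_le_ReIm _) _.
by rewrite cReD cReN cImD cImN [e]splitr lerD.
Qed.

End ultrafilter_limits.

Section compactness.
Variables (R : realType) (v : R -> {posnum R}).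
Local Notation C := R[i].
Variable mu : {measure set (measurableTypeR R) -> \bar R}.
Hypothesis v_cont : {within `[0, +oo[, continuous (fun r => (v r)%:num)}.
Hypothesis v_decr : forall r s : R, 0 <= r -> r <= s -> (v s)%:num <= (v r)%:num.
Hypothesis v_rapid : forall m : nat, r ^+ m * (v r)%:num @[r --> +oo] --> (0 : R).
Hypothesis v_ratio : forall t : R, 1 < t ->
    (v (t * r))%:num / (v r)%:num @[r --> +oo] --> (0 : R).
Hypothesis mu_bounded : hausdorff_bounded mu v.
Hypothesis mu1 : mu [set (1 : R)] = 0%E.
Implicit Types (f g : Hinf v) (z : C).

Definition unit_ball : set (Hinf v) := [set f | forall z, wabs v f z <= 1].

Lemma unit_ballE : unit_ball = [set f : Hinf v | `|f| <= 1].
Proof.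
apply/seteqP; split => f /=; rewrite hnormE -[1]/((1 : R)%:C) lecR.
  exact: hnorm_le.
by move=> h z; exact: le_trans (wabs_le_hnorm f z) h.
Qed.

Lemma unit_ball_bound f z (A : R) : unit_ball f -> normc z <= A ->
  normc (f z) <= ((v A)%:num)^-1.
Proof.
move=> f1 zA; have := normc_le_wabs (f1 z); rewrite div1r => /le_trans; apply.
by rewrite lef_pV2 ?posrE// v_decr ?normc_ge0.
Qed.

Lemma unit_ball_taylor2 f z (rho : R) : unit_ball f -> 0 < rho -> normc z <= rho ->
  exists2 d, normc d <= 4 * ((v (2 * rho))%:num)^-1 / rho &
  forall z', normc z' <= rho ->
    normc (f z' - f z - d * (z' - z)) <=
    4 * ((v (2 * rho))%:num)^-1 / rho ^+ 2 * normc (z' - z) ^+ 2.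
Proof.
move=> f1 rho0 zrho; apply: entire_taylor2 => //; first exact: Hinf_entire.
by move=> w wr; apply: unit_ball_bound => //; rewrite wr.
Qed.

(** 12 = 4 + 8: the linear term gives 4, and the quadratic one gives 8 because |z' - z| <= 2 rho.
    The constant does not depend on [f]. *)
Lemma unit_ball_lip f z z' (rho : R) : unit_ball f -> 0 < rho ->
  normc z <= rho -> normc z' <= rho ->
  normc (f z' - f z) <= 12 * ((v (2 * rho))%:num)^-1 / rho * normc (z' - z).
Proof.
move=> f1 rho0 zrho z'rho; have [d d1 /(_ z' z'rho) fd] := unit_ball_taylor2 f1 rho0 zrho.
rewrite -(subrK (d * (z' - z)) (f z' - f z)); apply: le_trans (le_normcD _ _) _.
set M := ((v (2 * rho))%:num)^-1 in d1 fd *; have M0 : 0 < M by rewrite invr_gt0.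
set s := normc (z' - z) in fd *; have s0 : 0 <= s := normc_ge0 _.
have s2 : s <= 2 * rho by rewrite /s; have := le_normcD z' (- z); rewrite normcN; lra.
rewrite normcM -/s.
have h1 : normc d * s <= 4 * M / rho * s by rewrite ler_wpM2r.
have h2 : 4 * M / rho ^+ 2 * s ^+ 2 <= 8 * M / rho * s.
  have -> : 8 * M / rho * s = 4 * M / rho ^+ 2 * (2 * rho * s).
    by field; rewrite gt_eqF.
  rewrite ler_wpM2l ?divr_ge0 ?mulr_ge0 ?exprn_ge0 ?(ltW M0) ?(ltW rho0)//.
  by rewrite expr2 ler_wpM2r.
have -> : 12 * M / rho * s = 8 * M / rho * s + 4 * M / rho * s.
  by field; rewrite gt_eqF.
by rewrite lerD// (le_trans fd).
Qed.

Section limit.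
Variable V : set_system (Hinf v).
Hypothesis UV : UltraFilter V.
Hypothesis Vball : V unit_ball.

Let FV : ProperFilter V. Proof. exact: ultra_proper. Qed.

Let VI A B : V A -> V B -> V (A `&` B). Proof. exact: filterI. Qed.

Let Vex A : V A -> exists f, A f. Proof. exact: filter_ex. Qed.

Lemma pointwise_limit : exists fs : C -> C^o, forall z (e : R), 0 < e ->
  V [set f : Hinf v | normc (f z - fs z) <= e].
Proof.
have lim z : exists l, forall e : R, 0 < e -> V [set f : Hinf v | normc (f z - l) <= e].
  apply: (@ultra_limit _ _ _ UV (fun f : Hinf v => f z) ((v (normc z))%:num)^-1).
  by apply: filterS Vball => f /unit_ball_bound; apply.
by have [fs hfs] := choice lim; exists fs.
Qed.

Variable fs : C -> C^o.
Hypothesis Vfs : forall z (e : R), 0 < e -> V [set f : Hinf v | normc (f z - fs z) <= e].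

(* The second order Taylor estimate is uniform on the ball, so it passes to the
   limit. *)
Lemma limit_entire : entire fs.
Proof.
move=> z; pose rho := normc z + 1.
have rho0 : 0 < rho by rewrite ltr_wpDl ?normc_ge0.
have zrho : normc z <= rho by rewrite lerDl.
set M := ((v (2 * rho))%:num)^-1; have M0 : 0 < M by rewrite invr_gt0.
(* The derivative at z becomes a bounded function [D] of f on the ball, so that it too has a limit
   along the ultrafilter. *)
have /choice[D hD] : forall f, exists d, unit_ball f -> normc d <= 4 * M / rho /\
    forall z', normc z' <= rho -> normc (f z' - f z - d * (z' - z)) <=
      4 * M / rho ^+ 2 * normc (z' - z) ^+ 2.
  move=> f; have [f1|nf] := pselect (unit_ball f); last by exists 0.
  by have [d d1 hd] := unit_ball_taylor2 f1 rho0 zrho; exists d.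
have [|d hd] := @ultra_limit _ _ _ UV D (4 * M / rho).
  by apply: filterS Vball => f /hD[].
set K := 4 * M / rho ^+ 2 in hD.
have K0 : 0 <= K by rewrite divr_ge0 ?mulr_ge0 ?exprn_ge0 ?(ltW M0) ?(ltW rho0).
have est z' : normc z' <= rho ->
    normc (fs z' - fs z - d * (z' - z)) <= K * normc (z' - z) ^+ 2.
  move=> z'rho; apply/ler_addgt0Pr => e e0.
  pose s := normc (z' - z); have s0 : 0 <= s := normc_ge0 _.
  have s2 : 0 < 2 + s by rewrite ltr_pwDl.
  (* The values at z and z' cost e1 each and the derivative costs e1 * s, in total e. *)
  pose e1 := e / (2 + s); have e10 : 0 < e1 by rewrite divr_gt0.
  have [f [[f1 fz'] [fz fd]]] : exists f, (unit_ball f /\ normc (f z' - fs z') <= e1) /\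
      (normc (f z - fs z) <= e1 /\ normc (D f - d) <= e1).
    have := VI (VI Vball (Vfs z' e10)) (VI (Vfs z e10) (hd _ e10)).
    by move=> /Vex[f [[? ?] [? ?]]]; exists f.
  have [_ /(_ z' z'rho) fT] := hD f f1.
  have -> : fs z' - fs z - d * (z' - z) =
     (f z' - f z - D f * (z' - z)) - (f z' - fs z') + (f z - fs z) + (D f - d) * (z' - z).
    by ring.
  set P := _ - D f * _ in fT *; set Q := f z' - fs z' in fz' *.
  set S := f z - fs z in fz *; have fd' := ler_wpM2r s0 fd.
  have t1 := le_normcD (P - Q + S) ((D f - d) * (z' - z)).
  have t2 := le_normcD (P - Q) S; have t3 := le_normcD P (- Q).
  rewrite normcN in t3; rewrite normcM -/s in t1.
  have eE : e = e1 + e1 + e1 * s by rewrite /e1; field; rewrite gt_eqF.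
  rewrite [X in _ <= _ + X]eE; lra.
apply: (@cderiv_derivable _ _ _ d) => e e0.
have K1 : 0 < K + 1 by rewrite ltr_wpDl.
exists (Num.min 1 (e / (K + 1))); first by rewrite lt_min ltr01 divr_gt0.
move=> w; rewrite lt_min ltr_pdivlMr// => /andP[w1 we].
have wrho : normc w <= rho by rewrite /rho; have := le_normcB w z; lra.
apply: le_trans (est _ wrho) _; rewrite expr2 mulrA ler_wpM2r ?normc_ge0//.
by apply: le_trans (ltW we); rewrite mulrC ler_wpM2l ?normc_ge0// lerDl.
Qed.

Lemma limit_wabs z : wabs v fs z <= 1.
Proof.
apply/ler_addgt0Pr => e e0.
have e1 : 0 < e / (v (normc z))%:num by rewrite divr_gt0.
have [f [f1 fz]] : exists f, unit_ball f /\ normc (f z - fs z) <= e / (v (normc z))%:num.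
  by have /Vex[f [? ?]] := VI Vball (Vfs z e1); exists f.
have := f1 z; rewrite /wabs => h1.
have := le_normcB (fs z) (f z); rewrite normcB => h2.
have : normc (fs z) <= normc (f z) + e / (v (normc z))%:num by lra.
move=> /(ler_wpM2r (ltW (weight_gt0 v (normc z)))); rewrite mulrDl divfK ?gt_eqF//.
lra.
Qed.

Lemma limit_in_Hinf : fs \in Hinf_pred v.
Proof. exact: Hinf_intro limit_entire limit_wabs. Qed.

Definition limit_fun : Hinf v := MkHinf limit_in_Hinf.

Lemma limit_ball : unit_ball limit_fun.
Proof. exact: limit_wabs. Qed.

(** An equi-Lipschitz family that converges pointwise converges uniformly on compact sets. The disc
    is enclosed in a square, a product of compact segments. *)
Lemma limit_locally_uniform (A e : R) : 0 < A -> 0 < e ->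
  V [set f : Hinf v | forall z, normc z <= A -> normc (f z - fs z) <= e].
Proof.
move=> A0 e0; pose c (p : R * R) : C := p.1 +i* p.2.
have K1 : compact (`[- A, A] `*` `[- A, A] : set (R * R)).
  by apply: compact_setX; exact: segment_compact.
have hV : \forall f \near V, `[- A, A] `*` `[- A, A] `<=`
    (fun p => normc ((f : Hinf v) (c p) - fs (c p)) <= e).
  have /compact_near_coveringP := K1; apply => p.
  rewrite /= !in_itv/= -!ler_norml => -[p1 p2].
  (* Points of the square have modulus at most 2A, and neighbours within distance 1 stay in the disc
     of radius rho, where [f] and the limit share the constant L. *)
  pose rho := 2 * A + 1; have rho0 : 0 < rho by rewrite /rho; lra.
  have cp : normc (c p) <= 2 * A.
    by apply: le_trans (normc_le_ReIm _) _ => /=; lra.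
  pose L := 12 * ((v (2 * rho))%:num)^-1 / rho.
  have L0 : 0 <= L by rewrite /L !mulr_ge0// invr_ge0 ltW.
  have L1 : 0 < L + 1 by rewrite ltr_wpDl.
  have e3 : 0 < e / 3 by rewrite divr_gt0.
  pose de := Num.min 1 (e / 3 / (L + 1)).
  have de0 : 0 < de by rewrite lt_min ltr01 !divr_gt0.
  have de2 : 0 < de / 2 by rewrite divr_gt0.
  exists (ball p (de / 2), [set f | unit_ball f /\ normc (f (c p) - fs (c p)) <= e / 3]).
    split; first exact: nbhsx_ballx.
    exact: VI Vball (Vfs _ e3).
  move=> [q f] [/= [q1 q2] [f1 fp]].
  have qp : normc (c q - c p) < de.
    apply: le_lt_trans (normc_le_ReIm _) _; rewrite cReD cReN cImD cImN /=.
    move: q1 q2; rewrite /ball/= distrC [in X in _ -> X -> _]distrC; lra.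
  have : normc (c q - c p) < 1 by apply: lt_le_trans qp _; rewrite ge_min lexx.
  have : normc (c q - c p) <= e / 3 / (L + 1).
    by apply: le_trans (ltW qp) _; rewrite ge_min lexx orbT.
  rewrite ler_pdivlMr// => qe q1'.
  have cq : normc (c q) <= rho by rewrite /rho; have := le_normcB (c q) (c p); lra.
  have cp' : normc (c p) <= rho by rewrite /rho; lra.
  have lf := unit_ball_lip f1 rho0 cp' cq.
  have ls := unit_ball_lip limit_ball rho0 cp' cq.
  rewrite -/L in lf ls.
  have sL : L * normc (c q - c p) <= e / 3.
    by apply: le_trans qe; rewrite mulrC ler_wpM2l ?normc_ge0// lerDl.
  have -> : f (c q) - fs (c q) = (f (c q) - f (c p)) + (f (c p) - fs (c p)) -
    (fs (c q) - fs (c p)) by ring.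
  apply: le_trans (le_normcD _ _) _; rewrite normcN.
  have := le_normcD (f (c q) - f (c p)) (f (c p) - fs (c p)).
  have {}ls : normc (fs (c q) - fs (c p)) <= e / 3 by apply: le_trans ls sL.
  lra.
apply: filterS hV => f hf z zA.
have := hf (complex.Re z, complex.Im z); rewrite /c /=.
have -> : complex.Re z +i* complex.Im z = z by case: (z).
apply; rewrite /= !in_itv/= -!ler_norml; split.
  exact: le_trans (normc_Re z) zA.
exact: le_trans (normc_Im z) zA.
Qed.

Lemma hausdorff_inf_limit (e : R) : 0 < e ->
  V [set f | hnorm (hausdorff_inf mu limit_fun - hausdorff_inf mu f) <= e].
Proof.
(* The difference of two elements of the ball is bounded by 2, so [tail_le_eps] yields 4 * eps, at
   most e / 2. *)
move=> e0; have e8 : 0 < e / 8 by rewrite divr_gt0.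
have [A A0 hA] := eps_vanish v_cont v_decr v_rapid v_ratio mu_bounded e8.
have I0 : 0 <= inv_mass mu.
  apply: Rintegral_ge0 => t; rewrite /= in_itv/= andbT => t1.
  by rewrite invr_ge0 ltW// (lt_trans ltr01).
have I1 : 0 < inv_mass mu + 1 by rewrite ltr_wpDl.
(* Undoes the factor 2 * inv_mass of [tail_le_disc] and the largest weight v(0). *)
pose e' := e / 2 / (inv_mass mu + 1) / (v 0)%:num.
have e'0 : 0 < e' by rewrite !divr_gt0.
apply: filterS (VI Vball (limit_locally_uniform A0 e'0)) => f [f1 fA] /=.
have m0 : mass1 mu = 0 by rewrite /mass1 mu1.
apply: hnorm_le => z.
have E g : hausdorff_inf mu g z = tail mu g z.
  rewrite (hausdorff_infE _ mu_bounded) (hausdorff_split v_decr v_rapid mu_bounded).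
  by rewrite m0 mul0r add0r.
rewrite /wabs.
have -> : (hausdorff_inf mu limit_fun - hausdorff_inf mu f : Hinf v) z =
    tail mu (limit_fun - f) z.
  by rewrite (tailB mu_bounded) -!E.
have [zA|/ltW Az] := leP (normc z) A.
  have fA' w : normc w <= A -> normc ((limit_fun - f) w) <= e'.
    by move=> wA; rewrite normcB; exact: fA.
  have := tail_le_disc v_decr v_rapid mu_bounded zA fA'.
  have v0 : (v (normc z))%:num <= (v 0)%:num by rewrite v_decr ?normc_ge0.
  move=> h; apply: le_trans (ler_pM (normc_ge0 _) (ltW (weight_gt0 _ _)) h v0) _.
  rewrite /e'.
  have -> : 2 * (e / 2 / (inv_mass mu + 1) / (v 0)%:num * inv_mass mu) * (v 0)%:num =
    e * (inv_mass mu / (inv_mass mu + 1)).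
    by field; rewrite !gt_eqF.
  by rewrite ler_piMr ?(ltW e0)// ler_pdivrMr// mul1r lerDl.
have z0 : z != 0 by rewrite -normc_gt0 (lt_le_trans A0).
have B2 w : wabs v (limit_fun - f) w <= 2.
  have := f1 w; have := limit_ball w; rewrite /wabs -!ler_pdivlMr// => h1 h2.
  apply: le_trans (le_normcD _ _) _; rewrite normcN; lra.
apply: le_trans (tail_le_eps v_cont v_decr v_rapid mu_bounded z0 B2) _.
by have := hA _ Az; lra.
Qed.

End limit.

Lemma mass1_eq0_compact : compact_operator (@hausdorff_inf R mu v).
Proof.
rewrite /compact_operator -unit_ballE.
suff cK : compact (@hausdorff_inf R mu v @` unit_ball).
  exists (@hausdorff_inf R mu v @` unit_ball) => //; split => //.
  by apply: compact_closed => //; exact: norm_hausdorff.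
move=> F FF FK.
(* [F] is pulled back to the unit ball, where a finer ultrafilter has a locally uniform limit; the
   image of that limit is a cluster point of [F]. *)
pose V0 := filter_from F (fun A => unit_ball `&` @hausdorff_inf R mu v @^-1` A).
have FV0 : ProperFilter V0.
  apply: filter_from_proper; last first.
    move=> A FA; have [_ [[f f1 <-] Af]] := @filter_ex _ F _ _ (@filterI _ F _ _ _ FK FA).
    by exists f.
  apply: filter_from_filter; first by exists setT; exact: filterT.
  move=> A B FA FB; exists (A `&` B); first exact: filterI.
  by move=> f [f1 [Af Bf]].
have [V [UV V0V]] := ultraFilterLemma FV0.
have Vball : V unit_ball.
  by apply: V0V; exists setT; [exact: filterT|move=> f []].
have [fs hfs] := pointwise_limit UV Vball.
exists (hausdorff_inf mu (limit_fun UV Vball hfs)); split.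
  by exists (limit_fun UV Vball hfs) => //; exact: limit_ball.
move=> A B FA /(@nbhs_normP C (Hinf v))[e /= e0 eB].
have eE := gt0_RRe e0.
have re2 : 0 < complex.Re e / 2 by rewrite divr_gt0//; move: e0; rewrite eE ltcR.
have VA : V (@hausdorff_inf R mu v @^-1` A).
  by apply: V0V; exists A => // f [].
have FV : ProperFilter V := @ultra_proper _ _ UV.
have [f [Af fB]] := @filter_ex _ V FV _
  (@filterI _ V _ _ _ VA (hausdorff_inf_limit UV Vball hfs re2)).
exists (hausdorff_inf mu f); split => //; apply: eB.
rewrite /= hnormE eE ltcR; apply: le_lt_trans fB _.
by rewrite ltr_pdivrMr// ltr_pMr ?ltr1n//; lra.
Qed.

End compactness.

Theorem theorem7p1 (R : realType) (v : R -> {posnum R})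
  (v_continuous : {within `[0, +oo[, continuous (fun r => (v r)%:num)})
  (v_decreasing : forall r s : R, 0 <= r -> r <= s -> (v s)%:num <= (v r)%:num)
  (v_rapid : forall m : nat, r ^+ m * (v r)%:num @[r --> +oo] --> (0 : R))
  (u_growth : (fine (wnorm v (fun z : R[i] => z ^+ n))) `^ (n%:R^-1)
                @[n --> \oo] --> +oo)
  (v_ratio : forall t : R, 1 < t ->
    (v (t * r))%:num / (v r)%:num @[r --> +oo] --> (0 : R))
  (mu : {measure set (measurableTypeR R) -> \bar R})
  (mu_bounded : hausdorff_bounded mu v) :
  [<-> compact_operator (@hausdorff_inf R mu v);
       weakly_compact_operator (@hausdorff_0 R mu v);
       mu [set (1 : R)] = 0%E].
Proof.
split; first exact: weakly_compact_hausdorff0.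
split; first exact: weakly_compact_mass1_eq0.
exact: mass1_eq0_compact.
Qed.
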